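(* Let $x_0\in\mathbb{R}^d$ be given (an image), let $p_\alpha$ be the probability density on $\mathbb{R}^d$ of noised data at a fixed noise level $\alpha>0$, and let $$B_0=\{x\in\mathbb{R}^d:\ \|\sqrt{1-\alpha}\,x_0-x\|_2<\sqrt{d\alpha}\}.$$ Let $\tilde{x}=\sqrt{1-\alpha}\,x_0+\sqrt{\alpha}\,u_d$, where $u_d$ is uniformly distributed on the sphere of radius $\sqrt{d}$ centered at the origin of $\mathbb{R}^d$. For a sample $x\sim\tilde{x}|x_0$ denote $u_d(x)=\frac{x-\sqrt{1-\alpha}\,x_0}{\sqrt{\alpha}}$. Then the following relation holds: $$-\,\mathbf{E}_{x\sim\tilde{x}|x_0}\left\langle \frac{\nabla\log p_\alpha(x)}{\|\nabla\log p_\alpha(x)\|_2},\ u_d(x)+\nabla\log p_\alpha(x)\right\rangle=\kappa(x_0)-D(x_0),$$ where $$\kappa(x_0)=\frac{-1}{|B_0|}\int_{B_0}\nabla\cdot\frac{\nabla\log p_\alpha(x)}{\|\nabla\log p_\alpha(x)\|_2}\,dx,\qquad D(x_0)=\frac{1}{|\partial B_0|}\int_{\partial B_0}\|\nabla\log p_\alpha(x)\|_2\,dx.$$ This provides a characterization of $x_0$ as a stable maximal point under the backward diffusion process $\dot{x}(\tau)=\nabla_x\log p(x(\tau))+\sqrt{2}\,\mathbf{w}_\tau$, quantifying both gradient magnitude (which should be low) and curvature (which should be high).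
   Context: $p_\alpha$ is the density of $\sqrt{1-\alpha}\,X_0+\sqrt{\alpha}\,\epsilon$, where $X_0$ is a random data point in $\mathbb{R}^d$ and $\epsilon\sim\mathcal{N}(0,I)$ is Gaussian noise; $\alpha$ is fixed, assumed small enough for $p_\alpha$ to approximate the data distribution, large enough for $p_\alpha$ to be smooth, and such that $x_0\in B_0$. $\langle\cdot,\cdot\rangle$ and $\|\cdot\|_2$ are the Euclidean inner product and norm, and $\nabla\cdot$ is the divergence. $|B_0|$ and $|\partial B_0|$ are the volumes of the ball $B_0$ and of its boundary sphere $\partial B_0$; conditionally on $x_0$, $\tilde{x}$ is uniformly distributed on $\partial B_0$, and the expectation is over this distribution with $x_0$ fixed. $\kappa(x_0)$ is called the curvature criterion and $D(x_0)$ the gradient criterion. In the backward diffusion process, $\dot{x}(\tau)$ is the time derivative of $x(\tau)$, $p$ is the probability density of the data, and $\mathbf{w}_\tau$ is the time derivative of Brownian motion $\mathbf{w}(\tau)$.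
   Formalization: κ(x₀) carries the factor √α, without which the identity is false; it is assumed that ∇log p_α has no zero on ∂B₀, finitely many zeros in B₀ (none if d=1), that the divergence in κ is integrable on B₀, and α≤1; the closing interpretive sentence is left out. *)

(* Defs.v *)
From HB Require Import structures.
From mathcomp Require Import all_boot all_order all_algebra.
From mathcomp Require Import all_classical all_reals all_analysis.
From mathcomp Require Import measurable_realfun.

Set Implicit Arguments.
Unset Strict Implicit.
Unset Printing Implicit Defensive.

Import Order.TTheory GRing.Theory Num.Theory.
Import numFieldNormedType.Exports.

Local Open Scope classical_set_scope.
Local Open Scope ring_scope.

(* R^d is 'rV[R]_d.  Its library norm `|x| is the sup norm, so the Euclidean
   inner product, norm, ball and sphere are defined here. *)
Section euclidean.
Context {R : realType} {d : nat}.
Implicit Types x y c : 'rV[R]_d.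

Definition dotp x y : R := \sum_(i < d) x 0 i * y 0 i.
Definition enorm x : R := Num.sqrt (dotp x x).
Definition eball c (r : R) : set 'rV[R]_d := [set x | enorm (c - x) < r].
Definition esphere c (r : R) : set 'rV[R]_d := [set x | enorm (c - x) = r].

Definition normalize x : 'rV[R]_d := (enorm x)^-1 *: x.

End euclidean.

Section calculus.
Context {R : realType} {d : nat}.

Definition partial (i : 'I_d) (f : 'rV[R]_d -> R) (x : 'rV[R]_d) : R :=
  'D_(delta_mx 0 i) f x.

Definition gradient (f : 'rV[R]_d -> R) (x : 'rV[R]_d) : 'rV[R]_d :=
  \row_(i < d) partial i f x.

Definition divergence (F : 'rV[R]_d -> 'rV[R]_d) (x : 'rV[R]_d) : R :=
  \sum_(i < d) partial i (fun y => F y 0 i) x.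

(* C^infinity: every iterated partial derivative exists and is continuous. *)
Definition smooth (f : 'rV[R]_d -> R) : Prop :=
  forall s : seq 'I_d, let g := foldr partial f s in
    continuous g /\
    forall (i : 'I_d) (x : 'rV[R]_d), derivable g x (delta_mx 0 i).

(* As ln r = 0 for r <= 0 and 'D_v f x = 0 where the limit fails to exist, the
   score is 0 at the zeros of a continuous p >= 0. *)
Definition score (p : 'rV[R]_d -> R) : 'rV[R]_d -> 'rV[R]_d :=
  gradient (fun x => ln (p x)).

End calculus.

(* The Borel sigma-algebra of R^d, generated by the coordinates. *)
Section measurable_rV.
Context {R : realType} (d : nat).

Definition coord_rV (i : 'I_d) (x : 'rV[R]_d) : measurableTypeR R := x 0 i.

Let rV_set0 : g_sigma_preimage coord_rV set0.
Proof. exact: sigma_algebra0. Qed.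

Let rV_setC A : g_sigma_preimage coord_rV A -> g_sigma_preimage coord_rV (~` A).
Proof. exact: sigma_algebraC. Qed.

Let rV_bigcup (F : (set 'rV[R]_d)^nat) :
  (forall i, g_sigma_preimage coord_rV (F i)) ->
  g_sigma_preimage coord_rV (\bigcup_i (F i)).
Proof. exact: sigma_algebra_bigcup. Qed.

Definition rV_display : measure_display.
Proof. exact: default_measure_display. Qed.

HB.instance Definition _ := @isMeasurable.Build rV_display
  'rV[R]_d (g_sigma_preimage coord_rV) rV_set0 rV_setC rV_bigcup.

End measurable_rV.

Lemma measurable_coord_rV (R : realType) d (i : 'I_d) :
  measurable_fun setT (@coord_rV R d i).
Proof.
move=> _ Y mY; rewrite setTI; apply: sub_sigma_algebra => /=.
rewrite -bigcup_seq/=; exists i => /=; first by rewrite mem_index_enum.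
by exists Y => //; rewrite setTI.
Qed.

Lemma measurable_fun_rV (R : realType) d dT (T : measurableType dT)
    (f : T -> 'rV[R]_d) :
  (forall i, measurable_fun setT (fun x => f x 0 i : measurableTypeR R)) ->
  measurable_fun setT f.
Proof.
move=> mf _ Y; rewrite setTI => mY.
pose S : set (set 'rV[R]_d) := [set Z | measurable (f @^-1` Z)].
suff : S Y by [].
move: Y mY; apply: smallest_sub; rewrite /S.
  split=> /=.
  - by rewrite preimage_set0; exact: measurable0.
  - by move=> A mA; rewrite setTD preimage_setC; exact: measurableC.
  - by move=> F mF; rewrite preimage_bigcup; exact: bigcup_measurable.
move=> A; rewrite -bigcup_seq/= => -[i _ [B mB <-]] /=.
rewrite setTI -comp_preimage -[X in measurable X]setTI.
exact: (mf i).
Qed.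

(* Lebesgue measure on R^d, as the d-fold product of the one on R. *)
Section lebesgue_rV.
Context {R : realType}.

Definition cons_rV d (p : measurableTypeR R * 'rV[R]_d) : 'rV[R]_d.+1 :=
  \row_i oapp (p.2 0) p.1 (unlift ord0 i).

Lemma measurable_cons_rV d : measurable_fun setT (@cons_rV d).
Proof.
apply: measurable_fun_rV => i.
under eq_fun do rewrite mxE.
case: unliftP => [j _|_] /=; last exact: measurable_fst.
exact: measurableT_comp (measurable_coord_rV j) measurable_snd.
Qed.

Section product.
Context {d : nat} (m : {sigma_finite_measure set 'rV[R]_d -> \bar R}).

Definition cons_measure : set 'rV[R]_d.+1 -> \bar R :=
  pushforward (@lebesgue_measure R \x m)%E (@cons_rV d).

Let cons_measure0 : cons_measure set0 = 0%E.
Proof. by rewrite /cons_measure /pushforward preimage_set0 measure0. Qed.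

Let cons_measure_ge0 A : (0 <= cons_measure A)%E.
Proof. by rewrite /cons_measure /pushforward; exact: measure_ge0. Qed.

Let cons_measure_sigma_additive : semi_sigma_additive cons_measure.
Proof.
move=> F mF tF mUF; rewrite /cons_measure /pushforward.
rewrite preimage_bigcup.
apply: measure_semi_sigma_additive.
- by move=> n; rewrite -[X in measurable X]setTI; exact: measurable_cons_rV.
- apply/trivIsetP => /= i j _ _ ij; rewrite -preimage_setI.
  by move/trivIsetP : tF => /(_ _ _ _ _ ij) ->//; rewrite preimage_set0.
- rewrite -preimage_bigcup -[X in measurable X]setTI.
  exact: measurable_cons_rV.
Qed.

HB.instance Definition _ := isMeasure.Build _ _ _ cons_measure
  cons_measure0 cons_measure_ge0 cons_measure_sigma_additive.

Let cons_measure_sigma_finite : sigma_finite setT cons_measure.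
Proof.
have /sigma_finiteP[F [TF ndF Foo]] := sigma_finiteT (@lebesgue_measure R).
have /sigma_finiteP[G [TG ndG Goo]] := sigma_finiteT m.
have FG : \bigcup_n (F n `*` G n) = setT.
  rewrite -subTset => -[x y] _.
  have [n _ Fnx] : (\bigcup_n F n) x by rewrite -TF.
  have [k _ Gky] : (\bigcup_n G n) y by rewrite -TG.
  exists (maxn n k) => //; split => /=.
  - by move: x Fnx; exact/subsetPset/ndF/leq_maxl.
  - by move: y Gky; exact/subsetPset/ndG/leq_maxr.
pose g (x : 'rV[R]_d.+1) : measurableTypeR R * 'rV[R]_d :=
  (x 0 ord0, \row_j x 0 (lift ord0 j)).
have gK : cancel (@cons_rV d) g.
  move=> [a v]; rewrite /g /cons_rV mxE unlift_none /=; congr pair.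
  by apply/rowP => j; rewrite !mxE liftK.
have mg : measurable_fun setT g.
  apply/measurable_fun_pairP; split; first exact: (measurable_coord_rV ord0).
  apply: measurable_fun_rV => i /=.
  under eq_fun do rewrite mxE.
  exact: (measurable_coord_rV (lift ord0 i)).
exists (fun n => g @^-1` (F n `*` G n)).
  by rewrite -preimage_bigcup FG preimage_setT.
move=> n; have [mF Fy] := Foo n; have [mG Gy] := Goo n; split.
  by rewrite -[X in measurable X]setTI; apply: mg => //; exact: measurableX.
rewrite /cons_measure /pushforward -comp_preimage (_ : _ \o _ = id); last first.
  by apply/funext => x; exact: gK.
by rewrite preimage_id product_measure1E// lte_mul_pinfty// ge0_fin_numE.
Qed.

HB.instance Definition _ := Measure_isSigmaFinite.Build _ _ _ cons_measure
  cons_measure_sigma_finite.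

End product.

Fixpoint lebesgue_rV d : {sigma_finite_measure set 'rV[R]_d -> \bar R} :=
  match d with
  | 0 => @dirac _ 'rV[R]_0 0 R
  | d'.+1 => cons_measure (lebesgue_rV d')
  end.

End lebesgue_rV.

Section sphere.
Context {R : realType} {d : nat}.
Implicit Types c x : 'rV[R]_d.

Lemma measurable_enorm_sub c :
  measurable_fun setT (fun x => enorm (c - x) : measurableTypeR R).
Proof.
have h i : measurable_fun setT
    (fun x : 'rV[R]_d => (c - x) 0 i : measurableTypeR R).
  under eq_fun do rewrite !mxE.
  apply: measurable_funB; first exact: measurable_cst.
  exact: measurable_coord_rV.
have hd : measurable_fun setT (fun x => dotp (c - x) (c - x)).
  by apply: measurable_sum => i; apply: measurable_funM; exact: h.
apply: (measurableT_comp _ hd).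
apply: nondecreasing_measurable => //= s t; exact: ler_wsqrtr.
Qed.

Lemma measurable_eball c (r : R) : measurable (eball c r).
Proof.
rewrite /eball -[X in measurable X]setTI.
have -> : [set x | enorm (c - x) < r] =
  (fun x => enorm (c - x)) @^-1` `]-oo, r[.
  by apply/seteqP; split => x /=; rewrite in_itv.
by apply: measurable_enorm_sub => //; exact: measurable_itv.
Qed.

Definition radial_proj c (r : R) x : 'rV[R]_d := c + r *: normalize (x - c).

Lemma measurable_radial_proj c r : measurable_fun setT (radial_proj c r).
Proof.
have mn : measurable_fun setT (fun x : 'rV[R]_d => (enorm (x - c))^-1).
  have -> : (fun x : 'rV[R]_d => (enorm (x - c))^-1) =
      (@powR R ^~ (-1)) \o (fun x => enorm (c - x)).
    apply/funext => x /=; rewrite powR_inv1 ?sqrtr_ge0//.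
    congr ((Num.sqrt _)^-1); apply: eq_bigr => i _.
    by rewrite !mxE -mulrNN !opprB.
  by apply: measurableT_comp (measurable_powR _) (measurable_enorm_sub c).
apply: measurable_fun_rV => i.
under eq_fun do rewrite !mxE.
apply: measurable_funD; first exact: measurable_cst.
apply: measurable_funM; first exact: measurable_cst.
apply: measurable_funM => //.
apply: measurable_funB; last exact: measurable_cst.
exact: measurable_coord_rV.
Qed.

Definition cone_volume c (r : R) : set 'rV[R]_d -> \bar R :=
  fun A => lebesgue_rV d (eball c r `&` radial_proj c r @^-1` A).

Section cone_volume_measure.
Variables (c : 'rV[R]_d) (r : R).

Let cone_volume0 : cone_volume c r set0 = 0%E.
Proof. by rewrite /cone_volume preimage_set0 setI0 measure0. Qed.

Let cone_volume_ge0 A : (0 <= cone_volume c r A)%E.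
Proof. exact: measure_ge0. Qed.

Let cone_volume_sigma_additive : semi_sigma_additive (cone_volume c r).
Proof.
have mproj (A : set 'rV[R]_d) : measurable A ->
    measurable (eball c r `&` radial_proj c r @^-1` A).
  move=> mA; apply: measurableI; first exact: measurable_eball.
  by rewrite -[X in measurable X]setTI; exact: measurable_radial_proj.
move=> F mF tF mUF; rewrite /cone_volume preimage_bigcup setI_bigcupr.
apply: measure_semi_sigma_additive.
- by move=> n; exact: mproj.
- apply/trivIsetP => /= i j _ _ ij; rewrite setIACA -preimage_setI.
  by move/trivIsetP : tF => /(_ _ _ _ _ ij) ->//; rewrite preimage_set0 setI0.
- by rewrite -setI_bigcupr -preimage_bigcup; exact: mproj.
Qed.

HB.instance Definition _ := isMeasure.Build _ _ _ (cone_volume c r)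
  cone_volume0 cone_volume_ge0 cone_volume_sigma_additive.

End cone_volume_measure.

(* Surface measure of the sphere of centre c and radius r > 0: a piece A of the
   sphere has area d / r times the volume of the cone over A with apex c. *)
Definition sphere_measure c (r : R) : set 'rV[R]_d -> \bar R :=
  mscale (d%:R / `|r|)%:nng (cone_volume c r).

HB.instance Definition _ c r := Measure.copy (sphere_measure c r)
  (mscale (d%:R / `|r|)%:nng (cone_volume c r)).

End sphere.

Section laws.
Context {R : realType} {d : nat} {dO : measure_display}.
Context {Omega : measurableType dO} (P : probability Omega R).

Definition independent_RV (X Y : {RV P >-> 'rV[R]_d}) : Prop :=
  forall A B : set 'rV[R]_d, measurable A -> measurable B ->
    (P (X @^-1` A `&` Y @^-1` B) = P (X @^-1` A) * P (Y @^-1` B))%E.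

Definition has_density (X : Omega -> 'rV[R]_d) (f : 'rV[R]_d -> R) : Prop :=
  (forall x, 0 <= f x) /\
  forall A : set 'rV[R]_d, measurable A ->
    P (X @^-1` A) = (\int[lebesgue_rV d]_(x in A) (f x)%:E)%E.

Definition standard_normal (X : {RV P >-> 'rV[R]_d}) : Prop :=
  has_density X (fun x => \prod_(i < d) normal_pdf 0 1 (x 0 i)).

Definition uniform_on_sphere (c : 'rV[R]_d) (r : R)
    (X : {RV P >-> 'rV[R]_d}) : Prop :=
  forall A : set 'rV[R]_d, measurable A ->
    P (X @^-1` A) = (fine (sphere_measure c r (A `&` esphere c r)) /
                     fine (sphere_measure c r (esphere c r)))%:E.

End laws.

Section criteria.
Context {R : realType} {d : nat}.
Variables (alpha : R) (x0 : 'rV[R]_d) (p : 'rV[R]_d -> R).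

Let c0 : 'rV[R]_d := Num.sqrt (1 - alpha) *: x0.
Let r0 : R := Num.sqrt (d%:R * alpha).

Definition B0 : set 'rV[R]_d := eball c0 r0.
Definition dB0 : set 'rV[R]_d := esphere c0 r0.

Definition kappa : R :=
  - (fine (lebesgue_rV d B0))^-1 *
    \int[lebesgue_rV d]_(x in B0) divergence (normalize \o score p) x.

Definition grad_crit : R :=
  (fine (sphere_measure c0 r0 dB0))^-1 *
    \int[sphere_measure c0 r0]_(x in dB0) enorm (score p x).

Definition xtilde (u : 'rV[R]_d) : 'rV[R]_d := c0 + Num.sqrt alpha *: u.

(* On the sphere dB0 of radius r0, u_of x is r0 / sqrt alpha = sqrt d times the
   outward unit normal at x.  Since d |B0| = r0 |dB0|, the mean over dB0 of the
   inner product of a field with u_of is sqrt alpha times the mean over B0 of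
   the divergence of that field. *)
Definition u_of (x : 'rV[R]_d) : 'rV[R]_d := (Num.sqrt alpha)^-1 *: (x - c0).

Definition critical_points : set 'rV[R]_d := [set x | score p x = 0].

End criteria.

(* Main.v *)
(** The field [F = normalize \o score p] is also the normalized gradient of [p]:
    where [p > 0] the score is [gradient p] divided by [p], and both vanish at
    the zeros of [p]. Hence [F] is [C^1] off the critical points. By the law of
    [u] the expectation is the mean over the sphere [dB0] of
    [dotp F u_of + enorm (score p)], so the claim is the divergence theorem for
    [F] on the ball [B0], where [F] may have finitely many singular points.

    The divergence theorem is obtained without a parametrization of the sphere.
    If [phi] is a [C^1] radial cutoff vanishing outside the ball, the divergence
    of [phi F] integrates to 0 (Fubini and the fundamental theorem of calculus
    on lines; the singular points are removable since [F] is bounded and [d >= 2]),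
    that is, the integral of [phi div F] is that of [- grad phi . F]. As [phi]
    increases to the indicator of the ball, [grad phi] concentrates near the
    sphere, where [F . x] may be replaced by its 0-homogeneous extension
    [gamma], and the dilation [x -> u x] shows that the resulting integral is
    [d] times that of [phi gamma]. The limit is the integral over the cone, which
    is how the surface measure is defined. *)

Require Import Defs.
From HB Require Import structures.
From mathcomp Require Import all_boot all_order all_algebra.
From mathcomp Require Import all_classical all_reals all_analysis.
From mathcomp Require Import measurable_realfun.
From mathcomp Require Import ring lra.

Set Implicit Arguments.
Unset Strict Implicit.
Unset Printing Implicit Defensive.

Import Order.TTheory GRing.Theory Num.Theory.
Import numFieldNormedType.Exports.

Local Open Scope classical_set_scope.
Local Open Scope ring_scope.

(** * Topology, measurability and the Euclidean norm *)

Section rV_topology.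
Context {R : realType} {d : nat}.
Implicit Types (x y z : 'rV[R]_d).

(** The delicate point is the replacement of [F . x] by its homogeneous extension: the radial
    derivative [w n] of the n-th cutoff is of order n, on a layer whose thickness is of order 1/n.
    The dilation identity applied to the constant function 1 controls it: the total mass of the
    nonnegative weight [w n] is at most [d] times the volume of the ball, for every n, while
    compactness of the sphere makes the error on the layer uniformly small. All spherical means,
    that of the random vector included, are expressed as averages over a ball of a function composed
    with [radial_proj], so that both sides of the claim become integrals over the same ball. Outside
    the closed ball the critical points of [p] are unrestricted, so the cutoffs have to vanish from
    the sphere on and increase to 1 from inside. They are functions of the squared distance, which
    keeps them C^1 at the centre, and C^1 is what the fundamental theorem of calculus asks for. *)

Lemma near_rV x (P : set 'rV[R]_d) :
  (\forall y \near x, P y) <->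
  exists2 e : R, 0 < e & forall y, (forall i, `|x 0 i - y 0 i| < e) -> P y.
Proof.
split.
  move=> /nbhs_ballP[e /= e0 xe]; exists e => // y xy; apply: xe.
  by split => // i j; rewrite (ord1 i); exact: xy.
move=> [e e0 h]; apply/nbhs_ballP; exists e => //= y [_ xy].
by apply: h => i; exact: xy.
Qed.

Lemma continuous_coord_rV (i : 'I_d) : continuous (fun x => x 0 i : R).
Proof. exact: coord_continuous. Qed.

Lemma continuous_sum_rV (f : 'I_d -> 'rV[R]_d -> R) x :
  (forall i, {for x, continuous (f i)}) ->
  {for x, continuous (fun y => \sum_(i < d) f i y)}.
Proof.
move=> cf; apply: (@cvg_big R _ +%R 0 xpredT _ _ (nbhs x) _ f (fun i => f i x) (nbhs_filter x)) => [|i _].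
  exact: add_continuous.
exact: cf.
Qed.

Lemma continuous_dotp (F G : 'rV[R]_d -> 'rV[R]_d) x :
  (forall i, {for x, continuous (fun y => F y 0 i)}) ->
  (forall i, {for x, continuous (fun y => G y 0 i)}) ->
  {for x, continuous (fun y => dotp (F y) (G y))}.
Proof.
by move=> cF cG; apply: continuous_sum_rV => i; apply: continuousM.
Qed.

(** The sigma-algebra is generated by the coordinates, so [U] is written as a countable union of
    cubes with rational centre and half-side 1/(k+1) contained in [U], enumerated by [unpickle]. *)
Lemma open_measurable_rV (U : set 'rV[R]_d) : open U -> measurable U.
Proof.
move=> oU.
pose c (q : 'rV[rat]_d) : 'rV[R]_d := \row_i ratr (q 0 i).
pose cube (q : 'rV[rat]_d) (k : nat) : set 'rV[R]_d :=
  [set x | forall i, `|c q 0 i - x 0 i| < k.+1%:R^-1].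
have mcube q k : measurable (cube q k).
  have -> : cube q k = \bigcap_(i in [set: 'I_d])
      ((@coord_rV R d i) @^-1` `]c q 0 i - k.+1%:R^-1, c q 0 i + k.+1%:R^-1[).
    apply/seteqP; split => x /= h i; first move=> _ /=.
      by have := h i; rewrite in_itv/= ltr_distlC.
    by have := h i Logic.I; rewrite /= in_itv/= ltr_distlC.
  apply: fin_bigcap_measurable => // i _.
  by rewrite -[X in measurable X]setTI; apply: measurable_coord_rV.
pose B n : set 'rV[R]_d := if @unpickle ('rV[rat]_d * nat)%type n is Some (q, k)
  then (if `[< cube q k `<=` U >] then cube q k else set0) else set0.
suff -> : U = \bigcup_n B n.
  apply: bigcupT_measurable => n; rewrite /B; case: unpickle => [[q k]|] //.
  by case: ifP.
apply/seteqP; split => [x Ux|x [n _]]; last first.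
  by rewrite /B; case: unpickle => [[q k]|] //; case: asboolP => [s /s|_ []].
have /near_rV[e e0 xe] : \forall y \near x, U y by exact: open_nbhs_nbhs.
(* Two points of a cube of half-side 1/(k+1) differ by less than 2/(k+1) < e in each coordinate, so
   a cube that contains [x] stays in [U]. *)
have [k ke] : exists k, k.+1%:R^-1 < e / 2.
  have [k _ /(_ _ (leqnn _)) h] := near_infty_natSinv_lt (PosNum (divr_gt0 e0 (ltr0Sn R 1))).
  by exists k.
have xq (i : 'I_d) : {q : rat | `|ratr q - x 0 i| < k.+1%:R^-1}.
  apply: cid; have [|q] := @rat_in_itvoo R (x 0 i - k.+1%:R^-1) (x 0 i + k.+1%:R^-1).
    by rewrite ltrD2l gtrN// invr_gt0.
  by rewrite in_itv/= -ltr_distlC distrC => ?; exists q.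
pose q : 'rV[rat]_d := \row_i sval (xq i).
have xcube : cube q k x.
  by move=> i; rewrite !mxE; case: (xq i).
exists (pickle (q, k)) => //; rewrite /B pickleK asboolT//.
move=> y qy; apply: xe => i.
have h1 : `|c q 0 i - y 0 i| < k.+1%:R^-1 := qy i.
have h2 : `|c q 0 i - x 0 i| < k.+1%:R^-1 := xcube i.
have := ler_distD (c q 0 i) (x 0 i) (y 0 i).
rewrite (distrC (x 0 i) (c q 0 i)) => h3.
move: h1 h2 h3 ke; set K : R := k.+1%:R^-1; set a : R := `|_|; set b : R := `|_|. lra.
Qed.

Lemma continuous_measurable_rV (f : 'rV[R]_d -> R) :
  continuous f -> measurable_fun setT f.
Proof.
move=> /continuousP cf.
apply: (measurability _ (RGenOpens.measurableE R)) => _ [_ [a [b ->] <-]].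
rewrite setTI; apply: open_measurable_rV; apply: cf; exact: interval_open.
Qed.

End rV_topology.

Section euclidean_theory.
Context {R : realType} {d : nat}.
Implicit Types (x y z c : 'rV[R]_d) (r k : R).

Lemma dotp_ge0 x : 0 <= dotp x x.
Proof. by apply: sumr_ge0 => i _; rewrite -expr2 sqr_ge0. Qed.

Lemma enorm_ge0 x : 0 <= enorm x. Proof. exact: sqrtr_ge0. Qed.

Lemma sqr_enorm x : enorm x ^+ 2 = dotp x x.
Proof. by rewrite sqr_sqrtr// dotp_ge0. Qed.

Lemma dotpZl k x y : dotp (k *: x) y = k * dotp x y.
Proof. by rewrite /dotp mulr_sumr; apply: eq_bigr => i _; rewrite !mxE mulrA. Qed.

Lemma dotpC x y : dotp x y = dotp y x.
Proof. by apply: eq_bigr => i _; rewrite mulrC. Qed.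

Lemma dotpZr k x y : dotp x (k *: y) = k * dotp x y.
Proof. by rewrite dotpC dotpZl dotpC. Qed.

Lemma dotpDr x y z : dotp x (y + z) = dotp x y + dotp x z.
Proof. by rewrite -big_split; apply: eq_bigr => i _; rewrite !mxE mulrDr. Qed.

Lemma enormZ k x : enorm (k *: x) = `|k| * enorm x.
Proof. by rewrite /enorm dotpZl dotpZr mulrA -expr2 sqrtrM ?sqr_ge0// sqrtr_sqr. Qed.

Lemma enormN x : enorm (- x) = enorm x.
Proof. by rewrite -scaleN1r enormZ normrN1 mul1r. Qed.

Lemma enormB x y : enorm (x - y) = enorm (y - x).
Proof. by rewrite -enormN opprB. Qed.

Lemma coord_le_enorm x i : `|x 0 i| <= enorm x.
Proof.
rewrite -sqrtr_sqr ler_wsqrtr// /dotp (bigD1 i)//= -expr2 lerDl.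
by apply: sumr_ge0 => j _; rewrite -expr2 sqr_ge0.
Qed.

Lemma enorm_eq0 x : (enorm x == 0) = (x == 0).
Proof.
apply/eqP/eqP => [x0|->]; last first.
  by rewrite -(scale0r (0 : 'rV[R]_d)) enormZ normr0 mul0r.
apply/rowP => i; rewrite mxE; apply/eqP; rewrite -normr_le0.
by rewrite -x0 coord_le_enorm.
Qed.

Lemma enorm_lt_sqrt x r : 0 < r -> (enorm x < r) = (dotp x x < r ^+ 2).
Proof.
by move=> r0; rewrite -sqr_enorm ltr_pXn2r// nnegrE ?enorm_ge0// ltW.
Qed.

Lemma enorm_le_sum x : enorm x <= \sum_(i < d) `|x 0 i|.
Proof.
rewrite -(@ler_pXn2r _ 2)// ?nnegrE ?enorm_ge0 ?sumr_ge0// sqr_enorm.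
rewrite expr2 mulr_suml; apply: ler_sum => i _.
rewrite (le_trans (ler_norm _))// normrM ler_wpM2l//.
by rewrite (bigD1 i)//= lerDl sumr_ge0.
Qed.

Lemma continuous_enorm (F : 'rV[R]_d -> 'rV[R]_d) x :
  (forall i, {for x, continuous (fun y => F y 0 i)}) ->
  {for x, continuous (fun y => enorm (F y))}.
Proof.
move=> cF; apply: (@continuous_comp _ _ _ (fun y => dotp (F y) (F y)) Num.sqrt).
  exact: continuous_dotp.
exact: sqrt_continuous.
Qed.

Lemma continuous_subl_coord c x i : {for x, continuous (fun y => (c - y) 0 i : R)}.
Proof.
have -> : (fun y => (c - y) 0 i : R) = (fun y => c 0 i - y 0 i).
  by apply/funext => y; rewrite !mxE.
by apply: continuousB; [exact: cst_continuous|exact: continuous_coord_rV].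
Qed.

Lemma continuous_subr_coord c x i : {for x, continuous (fun y => (y - c) 0 i : R)}.
Proof.
have -> : (fun y => (y - c) 0 i : R) = (fun y => y 0 i - c 0 i).
  by apply/funext => y; rewrite !mxE.
by apply: continuousB; [exact: continuous_coord_rV|exact: cst_continuous].
Qed.

End euclidean_theory.

(** * Lebesgue measure *)

(** The measure structure of a pushforward, which depends on the proof [mf] that the map is
    measurable. *)
Notation pushm mu mf :=
  (measure_function_pushforward__canonical__measure_function_Measure mu mf).

Section lebesgue_affine.
Context {R : realType}.
Local Open Scope ereal_scope.

(** Uniqueness of Lebesgue measure reduces this to the intervals ]b, c], whose preimages are ](b -
    a) / k, (c - a) / k]. *)
Lemma lebesgue_measure_affine (a k : R) (A : set (measurableTypeR R)) :
  (0 < k)%R -> measurable A ->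
  k%:E * lebesgue_measure ((fun x : R => a + k * x)%R @^-1` A) =
  lebesgue_measure A.
Proof.
move=> k0 mA.
have mT : measurable_fun [set: measurableTypeR R]
    (fun x : measurableTypeR R => (a + k * x)%R : measurableTypeR R).
  by apply: measurable_funD => //; exact: measurable_funM.
pose mu := mscale (NngNum (ltW k0)) (pushm (@lebesgue_measure R) mT).
rewrite [RHS](@lebesgue_measure_unique R mu)//.
move=> _ [[b c] _ <-] /=; rewrite /mscale/= /pushforward.
have -> : (fun x : R => a + k * x)%R @^-1` `]b, c]%classic =
    [set` `](b - a) / k, (c - a) / k]%R].
  apply/seteqP; split => x /=; rewrite !in_itv/= ltr_pdivrMr// ler_pdivlMr//;
  by rewrite ltrBlDl lerBrDl (mulrC x).
rewrite !lebesgue_measure_itv/= !lte_fin ltr_pM2r ?invr_gt0// ltrD2r.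
case: ifP => bc; last by rewrite mule0.
rewrite -!EFinB -EFinM; congr (_%:E).
by rewrite -mulrBl mulrCA mulfV ?gt_eqF// mulr1; ring.
Qed.

Lemma measurable_affine_rV d (c : 'rV[R]_d) (k : R) :
  measurable_fun setT (fun x : 'rV[R]_d => c + k *: x)%R.
Proof.
apply: measurable_fun_rV => i; under eq_fun do rewrite !mxE.
apply: measurable_funD => //; apply: measurable_funM => //.
exact: measurable_coord_rV.
Qed.

(** Induction on [d]: through [cons_rV] the map splits into an affine map of the line and one of the
    other coordinates, and uniqueness of the product measure reduces the claim to rectangles. *)
Lemma lebesgue_rV_affine d (c : 'rV[R]_d) (k : R) (A : set 'rV[R]_d) :
  (0 < k)%R -> measurable A ->
  (k ^+ d)%:E * lebesgue_rV d ((fun x => c + k *: x)%R @^-1` A) =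
  lebesgue_rV d A.
Proof.
move=> k0; elim: d c A => [|d IH] c A mA.
  rewrite expr0 mul1e /=.
  suff -> : (fun x => c + k *: x)%R = id by [].
  by apply/funext => x; apply/rowP => -[].
pose T1 (x : measurableTypeR R) : measurableTypeR R := (c 0 ord0 + k * x)%R.
pose c' : 'rV[R]_d := (\row_j c 0 (lift ord0 j))%R.
pose T2 (x : 'rV[R]_d) := (c' + k *: x)%R.
have mT1 : measurable_fun setT T1.
  by apply: measurable_funD => //; exact: measurable_funM.
have mT2 : measurable_fun setT T2 by exact: measurable_affine_rV.
pose T (z : measurableTypeR R * 'rV[R]_d) := (T1 z.1, T2 z.2).
have mT : measurable_fun setT T.
  apply/measurable_fun_pairP; split.
    exact: (measurableT_comp mT1 measurable_fst).
  exact: (measurableT_comp mT2 measurable_snd).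
have TE : (fun x => c + k *: x)%R \o @cons_rV R d = @cons_rV R d \o T.
  apply/funext => -[a v]; apply/rowP => i; rewrite /T/T1/T2/= !mxE/=.
  by case: unliftP => [j ->|->]/=; rewrite ?mxE.
pose m1 := @lebesgue_measure R \x lebesgue_rV d.
pose mu := mscale (NngNum (exprn_ge0 d.+1 (ltW k0))) (pushm m1 mT).
have mcA : measurable (@cons_rV R d @^-1` A).
  by rewrite -[X in measurable X]setTI; exact: measurable_cons_rV.
rewrite /= /cons_measure /pushforward -comp_preimage TE comp_preimage.
suff h : forall X, measurable X -> m1 X = mu X by rewrite [RHS](h _ mcA).
apply: product_measure_unique => X Y mX mY.
rewrite /mu/= /mscale/= /pushforward.
have -> : T @^-1` (X `*` Y) = (T1 @^-1` X) `*` (T2 @^-1` Y) by [].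
rewrite product_measure1E//; first last.
- by rewrite -[X in measurable X]setTI; exact: mT2.
- by rewrite -[X in measurable X]setTI; exact: mT1.
rewrite -(lebesgue_measure_affine (c 0 ord0)%R k0 mX) -(IH c' _ mY).
by rewrite exprS EFinM muleACA.
Qed.

End lebesgue_affine.

(** * Volumes of cubes, balls and points; integrability of bounded functions *)

Section lebesgue_rV_sets.
Context {R : realType}.
Local Open Scope ereal_scope.

(** The reference bounded sets: cubes about the origin are compact and pull back to rectangles under
    [cons_rV], which makes their volume explicit. *)
Definition cube {d} (M : R) : set 'rV[R]_d :=
  [set x | forall i, (`|x ord0 i| <= M)%R].

Lemma measurable_cube d M : measurable (@cube d M).
Proof.
have -> : @cube d M = \bigcap_(i in [set: 'I_d])
    ((@coord_rV R d i) @^-1` [set` `[(- M)%R, M]%R]).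
  apply/seteqP; split => x /= h i; first by move=> _ /=; rewrite in_itv/= -ler_norml; exact: h.
  by have := h i Logic.I; rewrite /= in_itv/= -ler_norml.
apply: fin_bigcap_measurable => // i _.
rewrite -[X in measurable X]setTI; exact: measurable_coord_rV.
Qed.

Lemma lebesgue_cube d (M : R) : (0 < M)%R ->
  lebesgue_rV d (cube M) = ((M *+ 2) ^+ d)%:E.
Proof.
move=> M0; elim: d => [|d IH] /=.
  by rewrite expr0 diracE mem_set//= => -[].
rewrite /cons_measure /pushforward.
have -> : @cons_rV R d @^-1` cube M = [set` `[(- M)%R, M]%R] `*` cube M.
  apply/seteqP; split => -[a v]; rewrite /cube/= in_itv/= -ler_norml.
    move=> h; split.
      by have := h ord0; rewrite mxE unlift_none.
    by move=> i; have := h (lift ord0 i); rewrite mxE liftK.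
  by move=> [h1 h2] i; rewrite mxE; case: unliftP => [j|] _ /=.
rewrite product_measure1E//; last exact: measurable_cube.
rewrite IH [X in X * _](lebesgue_measure_itv `[(- M)%R, M]%R)/= lte_fin -EFinB opprK -mulr2n.
by rewrite ifT ?exprS ?EFinM// gtrN.
Qed.

Lemma cube_lty d (M : R) : lebesgue_rV d (cube M) < +oo.
Proof.
have M0 : (0 < `|M| + 1)%R by rewrite ltr_wpDl.
rewrite (@le_lt_trans _ _ (lebesgue_rV d (cube (`|M| + 1)%R)))//.
  apply: le_measure; rewrite ?inE//=; [exact: measurable_cube..|].
  by move=> x h i; rewrite (le_trans (h i))// (le_trans (ler_norm M))// lerDl.
by rewrite lebesgue_cube// ltry.
Qed.

Lemma eball_sub_cube d (c : 'rV[R]_d) r : eball c r `<=` cube (enorm c + r)%R.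
Proof.
move=> x xr i; have := coord_le_enorm (c - x)%R i; rewrite !mxE => cx.
have := ler_normB (c ord0 i) (c ord0 i - x ord0 i)%R.
rewrite subKr => /le_trans; apply.
by rewrite lerD ?coord_le_enorm// (le_trans cx)// ltW.
Qed.

Lemma eball_lty d (c : 'rV[R]_d) r : lebesgue_rV d (eball c r) < +oo.
Proof.
apply: le_lt_trans (cube_lty d (enorm c + r)%R).
apply: le_measure; rewrite ?inE//; [exact: measurable_eball|exact: measurable_cube|].
exact: eball_sub_cube.
Qed.

Lemma fin_eball d (c : 'rV[R]_d) r : lebesgue_rV d (eball c r) \is a fin_num.
Proof. by rewrite ge0_fin_numE// eball_lty. Qed.

Lemma lebesgue_eball_scale d (c : 'rV[R]_d) r : (0 < r)%R ->
  lebesgue_rV d (eball c r) = (r ^+ d)%:E * lebesgue_rV d (eball 0%R 1%R).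
Proof.
move=> r0; rewrite -(lebesgue_rV_affine c r0)//; last exact: measurable_eball.
congr (_ * lebesgue_rV d _); apply/seteqP; split => x; rewrite /eball/=;
by rewrite opprD addrA subrr !sub0r !enormN enormZ gtr0_norm// gtr_pMr.
Qed.

Lemma eball_gt0 d (c : 'rV[R]_d) r : (0 < r)%R -> 0 < lebesgue_rV d (eball c r).
Proof.
move=> r0; rewrite lebesgue_eball_scale// mule_gt0 ?lte_fin ?exprn_gt0//.
(* The cube of half-side 1/(d+1) lies in the unit ball: the Euclidean norm is at most the sum of the
   absolute coordinates, here at most d/(d+1) < 1. *)
have d1 : (0 < d.+1%:R^-1 :> R)%R by rewrite invr_gt0.
rewrite (@lt_le_trans _ _ (lebesgue_rV d (cube d.+1%:R^-1)))//.
  by rewrite lebesgue_cube// lte_fin exprn_gt0// mulrn_wgt0.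
apply: le_measure; rewrite ?inE//; [exact: measurable_cube|exact: measurable_eball|].
move=> x h; rewrite /eball/= sub0r enormN (le_lt_trans (enorm_le_sum _))//.
rewrite (@le_lt_trans _ _ (\sum_(i < d) d.+1%:R^-1)%R)//.
  by apply: ler_sum => i _; exact: h.
rewrite sumr_const card_ord -[X in (X < _)%R]mulr_natl ltr_pdivrMr// mul1r.
by rewrite ltr_nat.
Qed.

Lemma measurable_set1_rV d (z : 'rV[R]_d) : measurable [set z].
Proof.
have -> : [set z] = \bigcap_(i in [set: 'I_d]) ((@coord_rV R d i) @^-1` [set z ord0 i]).
  apply/seteqP; split => [x -> //|x h]; apply/rowP => i.
  exact: (h i Logic.I).
apply: fin_bigcap_measurable => // i _.
by rewrite -[X in measurable X]setTI; apply: measurable_coord_rV => //.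
Qed.

Lemma lebesgue_rV_set1 d (z : 'rV[R]_d) : (0 < d)%N -> lebesgue_rV d [set z] = 0.
Proof.
move=> d0; apply/eqP; rewrite eq_le measure_ge0 andbT; apply/lee_addgt0Pr => e e0.
rewrite add0e; have /fineK := fin_eball (0 : 'rV[R]_d) 1%R.
set V := fine _ => VE; have V0 : (0 <= V)%R by rewrite fine_ge0.
(* [r <= 1] and [0 < d] give [r ^ d <= r]. The 1 added to [V] makes the divisor positive, [V] being
   only known to be nonnegative. *)
pose r := (Num.min 1 (e / (V + 1)))%R.
have r0 : (0 < r)%R by rewrite lt_min ltr01/= divr_gt0// ltr_wpDl.
apply: (@le_trans _ _ (lebesgue_rV d (eball z r))).
  apply: le_measure; rewrite ?inE; [exact: measurable_set1_rV|exact: measurable_eball|].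
  move=> _ ->; rewrite /eball/= subrr; have /eqP := enorm_eq0 (0 : 'rV[R]_d).
  by rewrite eqxx => /eqP/eqP ->.
rewrite lebesgue_eball_scale// -VE -EFinM lee_fin.
apply: (@le_trans _ _ (r * V)%R).
  rewrite ler_wpM2r// -[leRHS]expr1 ler_wiXn2l//; first exact: ltW.
  by rewrite ge_min lexx.
apply: (@le_trans _ _ (e / (V + 1) * (V + 1))%R); last first.
  by rewrite divfK// gt_eqF// ltr_wpDl.
by apply: ler_pM => //; [exact: ltW|rewrite ge_min lexx orbT|rewrite lerDl].
Qed.

Lemma bounded_integrable dT (T : measurableType dT) (mu : {measure set T -> \bar R})
    (D : set T) (f : T -> R) (K : R) : measurable D -> mu D < +oo ->
  measurable_fun D f -> (forall x, D x -> (`|f x| <= K)%R) ->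
  mu.-integrable D (EFin \o f).
Proof.
move=> mD Doo mf fK; apply: measurable_bounded_integrable => //.
exists K; split; first exact: num_real.
by move=> y Ky x Dx; apply: le_trans (fK _ Dx) _; exact: ltW.
Qed.

Lemma integrable_vanish dT (T : measurableType dT) (mu : {measure set T -> \bar R})
    (D : set T) (f : T -> \bar R) : measurable D ->
  (forall x, ~ D x -> f x = 0) -> mu.-integrable D f -> mu.-integrable setT f.
Proof.
move=> mD f0 /(integrable_mkcond _ mD); congr (integrable _ _ _).
apply/funext => x; rewrite patchE; case: ifPn => // /negP xD.
by rewrite f0// => Dx; apply: xD; rewrite inE.
Qed.

Lemma integral_vanish dT (T : measurableType dT) (mu : {measure set T -> \bar R})
    (D : set T) (f : T -> \bar R) :
  (forall x, ~ D x -> f x = 0) -> \int[mu]_x f x = \int[mu]_(x in D) f x.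
Proof.
move=> f0; rewrite [RHS]integral_mkcond; apply: eq_integral => x _.
rewrite patchE; case: ifPn => // /negP xD.
by rewrite f0// => Dx; apply: xD; rewrite inE.
Qed.

Lemma bounded_support_integrable d (f : 'rV[R]_d -> R) (M K : R) :
  measurable_fun setT f -> (forall x, (`|f x| <= K)%R) ->
  (forall x, ~ cube M x -> f x = 0%R) ->
  (lebesgue_rV d).-integrable setT (EFin \o f).
Proof.
move=> mf fK f0; apply: (@integrable_vanish _ _ _ (cube M)).
- exact: measurable_cube.
- by move=> x /f0 /= ->.
- apply: (@bounded_integrable _ _ _ _ _ K) => //; first exact: measurable_cube.
  + exact: cube_lty.
  + exact: measurable_funTS.
Qed.

(** By construction [lebesgue_rV d.+1] is the image of a product measure under [cons_rV]; pulling
    back along this map gives access to Fubini. *)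
Lemma integrable_cons d (f : 'rV[R]_d.+1 -> \bar R) :
  (lebesgue_rV d.+1).-integrable setT f ->
  (lebesgue_measure \x lebesgue_rV d).-integrable setT (f \o @cons_rV R d).
Proof.
move=> /integrableP[mf foo]; apply/integrableP; split.
  by apply: measurableT_comp => //; exact: measurable_cons_rV.
move: foo; rewrite (eq_measure_integral
  (pushm (lebesgue_measure \x lebesgue_rV d) (@measurable_cons_rV R d)))//.
rewrite ge0_integral_pushforward//; first exact: measurable_cons_rV.
exact: measurableT_comp.
Qed.

Lemma integral_cons d (f : 'rV[R]_d.+1 -> \bar R) :
  (lebesgue_rV d.+1).-integrable setT f ->
  \int[lebesgue_rV d.+1]_x f x =
  \int[lebesgue_measure \x lebesgue_rV d]_z f (cons_rV z).
Proof.
move=> intf; rewrite (eq_measure_integral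
  (pushm (lebesgue_measure \x lebesgue_rV d) (@measurable_cons_rV R d)))//.
rewrite integral_pushforward//; first exact: measurable_cons_rV.
  by case/integrableP: intf.
exact: integrable_cons.
Qed.

End lebesgue_rV_sets.

(** * Integrals of partial derivatives *)

Section regularity.
Context {R : realType} {d : nat}.

Lemma continuous_rV (T : topologicalType) (f : T -> 'rV[R]_d) x :
  (forall i, {for x, continuous (fun y => f y 0 i : R)}) -> {for x, continuous f}.
Proof.
move=> cf P /near_rV[e e0 h].
have : \forall y \near x, forall i : 'I_d, `|f x 0 i - f y 0 i| < e.
  apply: filter_forall => i.
  by have /cvgrPdist_lt/(_ e e0) := cf i.
by apply: filterS => y /h.
Qed.

Lemma compact_bound (A : set 'rV[R]_d) (f : 'rV[R]_d -> R) : compact A ->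
  (forall x, A x -> {for x, continuous f}) ->
  exists2 K, 0 <= K & forall x, A x -> `|f x| <= K.
Proof.
move=> cA cf.
have : compact (f @` A).
  apply: continuous_compact => //; apply: continuous_in_subspaceT => x.
  by rewrite inE => /cf.
move=> /compact_bounded[K [_ hK]]; exists (`|K| + 1); first by rewrite addr_ge0.
move=> x Ax; apply: (hK (`|K| + 1)); last by exists x.
by rewrite (le_lt_trans (ler_norm K))// ltrDl.
Qed.

Lemma compact_cube (M : R) : compact (@cube R d M).
Proof.
have := @rV_compact R d (fun=> `[- M, M]%classic) (fun=> @segment_compact _ _ _).
congr compact; apply/seteqP; split => x h i; have := h i; rewrite /= in_itv/= -ler_norml//.
Qed.

(** A derivative along [v] sees the function on one line only. This moves derivatives between
    ['rV[R]_d], its slices and the real line. *)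
Lemma is_derive_line (V W : normedModType R) (f : V -> R) (g : W -> R) x v y w df :
  (forall h : R, f (h *: v + x) = g (h *: w + y)) ->
  is_derive x v f df -> is_derive y w g df.
Proof.
move=> fg [dv dE].
have E : (fun h : R => h^-1 *: ((f \o shift x) (h *: v) - f x)) =
    (fun h : R => h^-1 *: ((g \o shift y) (h *: w) - g y)).
  apply/funext => h /=; rewrite fg.
  by have := fg 0; rewrite !scale0r !add0r => ->.
by split; [move: dv; rewrite /derivable E|move: dE; rewrite /derive E].
Qed.

End regularity.

Section integral_partial.
Context {R : realType}.

Lemma integral_derivative0 (g dg : R -> R) (M : R) : 0 < M ->
  (forall a, is_derive a (1 : R) g (dg a)) -> continuous dg ->
  (forall a, M < `|a| -> g a = 0 /\ dg a = 0) ->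
  (\int[lebesgue_measure]_a (dg a)%:E = 0)%E.
Proof.
move=> M0 gdg cdg g0; pose N := M + 1.
have MN : M < N by rewrite ltrDl.
have N0 : 0 < N by rewrite (lt_trans M0).
have -> : (\int[lebesgue_measure]_a (dg a)%:E =
    \int[lebesgue_measure]_(a in [set` `[- N, N]%R]) (dg a)%:E)%E.
  apply: integral_vanish => a; rewrite /= in_itv/= -ler_norml => /negP; rewrite -ltNge => Na.
  by have [_ ->] := g0 a (lt_trans MN Na).
have cg : continuous g.
  move=> a; apply: differentiable_continuous; apply/derivable1_diffP.
  by have [] := gdg a.
rewrite (@continuous_FTC2 _ dg g).
- have [|-> _] := g0 N; first by rewrite gtr0_norm.
  have [|-> _] := g0 (- N); first by rewrite normrN gtr0_norm.
  by rewrite sube0.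
- by rewrite gtrN.
- exact: continuous_subspaceT.
- split => /=.
  + by move=> a _; have [] := gdg a.
  + exact/cvg_at_right_filter/cg.
  + exact/cvg_at_left_filter/cg.
- by move=> a _; rewrite derive1E; have [_ ->] := gdg a.
Qed.

Lemma cons_rV_cubeP d (M a : R) (v : 'rV[R]_d) :
  cube M (cons_rV (a, v)) <-> `|a| <= M /\ cube M v.
Proof.
split=> [h|[h1 h2] i].
  split; first by have := h ord0; rewrite mxE unlift_none.
  by move=> i; have := h (lift ord0 i); rewrite mxE liftK.
by rewrite mxE; case: unliftP => [j|] _ /=.
Qed.

Lemma continuous_cons_rVl d (v : 'rV[R]_d) :
  continuous (fun a : R => @cons_rV R d (a, v)).
Proof.
move=> a; apply: continuous_rV => i.
have -> : (fun y : R => @cons_rV R d (y, v) 0 i : R) =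
    (fun y => oapp (v 0) y (unlift ord0 i)) by apply/funext => y; rewrite mxE.
by case: unliftP => [j|] _ /=; [exact: cst_continuous|exact: cvg_id].
Qed.

Lemma continuous_cons_rVr d (a : R) :
  continuous (fun v : 'rV[R]_d => @cons_rV R d (a, v)).
Proof.
move=> v; apply: continuous_rV => i.
have -> : (fun y : 'rV[R]_d => @cons_rV R d (a, y) 0 i : R) =
    (fun y => oapp (y 0) a (unlift ord0 i)) by apply/funext => y; rewrite mxE.
by case: unliftP => [j|] _ /=; [exact: continuous_coord_rV|exact: cst_continuous].
Qed.

(** Induction on [d], the order of integration being chosen by the direction: for the first
    coordinate the inner integral runs along lines and vanishes by the fundamental theorem of
    calculus; for any other it runs over a slice, where the induction hypothesis applies. *)
Lemma integral_partial0 d (i : 'I_d) (f D : 'rV[R]_d -> R) (M : R) : 0 < M ->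
  (forall x, is_derive x (delta_mx 0 i) f (D x)) -> continuous D ->
  (forall x, ~ cube M x -> f x = 0 /\ D x = 0) ->
  (\int[lebesgue_rV d]_x (D x)%:E = 0)%E.
Proof.
move=> M0; elim: d i f D => [[]//|d IH] i f D fD cD fD0.
have [K K0 DK] := compact_bound (@compact_cube _ _ M) (fun x _ => cD x).
have intD : (lebesgue_rV d.+1).-integrable setT (EFin \o D).
  apply: (@bounded_support_integrable _ _ _ M K).
  - exact: continuous_measurable_rV.
  - move=> x; have [/DK //|/fD0[_ ->]] := pselect (cube M x).
    by rewrite normr0.
  - by move=> x /fD0[].
rewrite integral_cons//; have intD' := integrable_cons intD.
have [j ij|ij] := unliftP ord0 i; rewrite {i}ij in fD.
- rewrite -integral12_prod_meas1//=; apply: integral0_eq => a _.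
  apply: (IH j (fun v => f (cons_rV (a, v)))).
  + move=> v; apply: is_derive_line (fD (cons_rV (a, v))) => h.
    congr f; apply/rowP => k; rewrite !mxE/=.
    case: unliftP => [k' ->|->]/=; last by rewrite mulr0 add0r.
    by rewrite !mxE (inj_eq lift_inj).
  + move=> v; apply: (@continuous_comp _ _ _ (fun v => cons_rV (a, v)) D).
      exact: continuous_cons_rVr.
    exact: cD.
  + by move=> v vM; apply: fD0 => /cons_rV_cubeP[].
- rewrite -integral21_prod_meas1//=; apply: integral0_eq => v _.
  apply: (@integral_derivative0 (fun a => f (cons_rV (a, v))) _ M) => //.
  + move=> a; apply: is_derive_line (fD (cons_rV (a, v))) => h.
    congr f; apply/rowP => k; rewrite !mxE/=.
    case: unliftP => [k' ->|->]/=; last by rewrite mulr1 [_%:A]mulr1.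
    by rewrite mulr0 add0r.
  + move=> a; apply: (@continuous_comp _ _ _ (fun a => cons_rV (a, v)) D).
      exact: continuous_cons_rVl.
    exact: cD.
  + by move=> a aM; apply: fD0 => /cons_rV_cubeP[]; rewrite leNgt aM.
Qed.

End integral_partial.

(** * Cutoff functions and removable singularities *)

Section cutoff.
Context {R : realType}.
Implicit Types s t : R.

(** An elementary C^1 function that is flat on a half-line; composing two of them gives a cutoff
    with an explicit derivative. *)
Definition sqpos s : R := Num.max s 0 ^+ 2.

Lemma continuous_max0 : continuous (fun s : R => Num.max s 0).
Proof.
move=> s; apply: (@continuous_max _ _ id (cst 0)); first exact: cvg_id.
exact: cst_continuous.
Qed.

Lemma is_derive_sqpos s : is_derive s (1 : R) sqpos (2 * Num.max s 0).
Proof.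
have [s0|s0|->] := ltgtP s 0.
- rewrite mulr0; apply: (near_eq_is_derive (f := cst 0)).
    near=> t; rewrite /sqpos max_r ?expr0n//.
    by apply: ltW; near: t; exact: lt_nbhsl.
- apply: (near_eq_is_derive (f := (@id R) ^+ 2)).
    near=> t; rewrite /sqpos max_l//.
    by apply: ltW; near: t; exact: lt_nbhsr.
  by apply: is_derive_eq; rewrite expr1 [_ *: _]mulr1.
(* At 0 the slope of [sqpos] is the positive part itself, which is continuous with value 0. *)
- rewrite mulr0; apply/is_derive1_caratheodory.
  exists (fun t => Num.max t 0); split.
  + move=> t; rewrite /sqpos maxxx expr0n/= !subr0 expr2.
    by have [t0|t0] := leP t 0; rewrite ?mul0r// ?mulr0.
  + exact: continuous_max0.
  + by rewrite maxxx.
Unshelve. all: by end_near. Qed.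

Lemma sqpos0 s : s <= 0 -> sqpos s = 0.
Proof. by move=> s0; rewrite /sqpos max_r// expr0n. Qed.

(* [C^1], equal to 1 on ]-oo, 0] and to 0 on [1, +oo[. *)
Definition step s : R := sqpos (1 - sqpos s).

Definition dstep s : R := - (4 * Num.max (1 - sqpos s) 0 * Num.max s 0).

Lemma is_derive_step s : is_derive s (1 : R) step (dstep s).
Proof.
have h1 := is_derive_sqpos s; have h2 := is_derive_sqpos (1 - sqpos s).
have h3 : is_derive s (1 : R) (fun s => 1 - sqpos s) (- (2 * Num.max s 0)).
  have := is_deriveB (is_derive_cst (1 : R) s (1 : R)) h1.
  by rewrite sub0r.
have := @is_derive1_comp _ sqpos (fun s => 1 - sqpos s) s _ _ h2 h3.
suff -> : dstep s = 2 * Num.max (1 - sqpos s) 0 * - (2 * Num.max s 0) by [].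
by rewrite /dstep; ring.
Qed.

Lemma continuous_sqpos : continuous sqpos.
Proof.
move=> s; apply: differentiable_continuous; apply/derivable1_diffP.
by have [] := is_derive_sqpos s.
Qed.

Lemma continuous_step : continuous step.
Proof.
move=> s; apply: differentiable_continuous; apply/derivable1_diffP.
by have [] := is_derive_step s.
Qed.

Lemma continuous_dstep : continuous dstep.
Proof.
move=> s; apply: (@continuousN _ _ _ (fun s : R => 4 * Num.max (1 - sqpos s) 0 * Num.max s 0)).
apply: continuousM; last exact: continuous_max0.
apply: continuousM; first exact: cst_continuous.
apply: (@continuous_comp _ _ _ (fun s => 1 - sqpos s) (fun t => Num.max t 0)).
  by apply: continuousB; [exact: cst_continuous|exact: continuous_sqpos].
exact: continuous_max0.
Qed.

Lemma sqpos_ge0 s : 0 <= sqpos s. Proof. exact: sqr_ge0. Qed.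

Lemma sqpos_ge1 s : 1 <= s -> 1 <= sqpos s.
Proof. by move=> s1; rewrite /sqpos max_l ?exprn_ege1// (le_trans ler01). Qed.

Lemma step_le0 s : s <= 0 -> step s = 1.
Proof. by move=> s0; rewrite /step (sqpos0 s0) subr0 /sqpos max_l// expr1n. Qed.

Lemma step_ge1 s : 1 <= s -> step s = 0.
Proof. by move=> s1; rewrite /step sqpos0// subr_le0 sqpos_ge1. Qed.

Lemma step_ge0 s : 0 <= step s. Proof. exact: sqpos_ge0. Qed.

Lemma step_le1 s : step s <= 1.
Proof.
rewrite /step /sqpos -[leRHS](expr1n _ 2) ler_pXn2r ?nnegrE ?le_max ?lexx ?orbT//.
by rewrite ge_max ler01 gerBl sqpos_ge0.
Qed.

Lemma dstep_le0 s : s <= 0 -> dstep s = 0.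
Proof. by move=> s0; rewrite /dstep (max_r s0) mulr0 oppr0. Qed.

Lemma dstep_ge1 s : 1 <= s -> dstep s = 0.
Proof.
move=> s1; rewrite /dstep [X in 4 * X]max_r ?mulr0 ?mul0r ?oppr0//.
by rewrite subr_le0 sqpos_ge1.
Qed.

Lemma dstep_npos s : dstep s <= 0.
Proof. by rewrite oppr_le0 !mulr_ge0// le_max lexx orbT. Qed.

(** Below 1 both positive parts in [dstep] lie between 0 and 1, which leaves the factor 4. *)
Lemma dstep_bound s : `|dstep s| <= 4.
Proof.
have [s1|s1] := leP 1 s; first by rewrite dstep_ge1// normr0.
rewrite ler0_norm ?dstep_npos// opprK -mulrA -[leRHS]mulr1 ler_pM2l//.
rewrite -[leRHS]mulr1 ler_pM// ?le_max ?lexx ?orbT//.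
- by rewrite ge_max ler01 gerBl sqpos_ge0.
- by rewrite ge_max ler01 ltW.
Qed.

Lemma step_lipschitz s t : `|step s - step t| <= 4 * `|s - t|.
Proof.
wlog st : s t / t <= s => [h|].
  by have [/h//|/ltW/h] := leP t s; rewrite distrC (distrC t).
have [||u _ ->] := @MVT_segment _ step dstep t s st.
- by move=> x _; exact: is_derive_step.
- by apply: continuous_subspaceT; exact: continuous_step.
- by rewrite normrM ler_wpM2r// dstep_bound.
Qed.

End cutoff.

Section derive_line.
Context {R : realType} {V : normedModType R}.

(** Along the line through [x] directed by [v] this is the chain rule in one variable; of [f], only
    the derivative in that direction is used. *)
Lemma is_derive_comp (f : V -> R) (phi : R -> R) x v df dphi :
  is_derive x v f df -> is_derive (f x) (1 : R) phi dphi ->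
  is_derive x v (phi \o f) (dphi * df).
Proof.
move=> hf hphi.
have h1 : is_derive (0 : R) (1 : R) (fun h : R => f (h *: v + x)) df.
  by apply: is_derive_line hf => h; rewrite addr0 [_%:A]mulr1.
have h2 : is_derive (f (0 *: v + x)) (1 : R) phi dphi by rewrite scale0r add0r.
have h3 := @is_derive1_comp _ phi (fun h : R => f (h *: v + x)) 0 _ _ h2 h1.
by apply: is_derive_line h3 => h /=; rewrite addr0 [_%:A]mulr1.
Qed.

Lemma is_derive_near0 (f : V -> R) x v :
  (\forall y \near x, f y = 0) -> is_derive x v f 0.
Proof.
move=> f0; apply: (near_eq_is_derive (f := cst 0)).
by apply: filterS f0 => y.
Qed.

End derive_line.

Section radial_cutoff.
Context {R : realType} {d : nat}.
Implicit Types (c x : 'rV[R]_d).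

(** Cutoffs are built on the squared distance because it is differentiable at [c], unlike
    [enorm (x - c)]. *)
Definition sqdist c x : R := dotp (x - c) (x - c).

Lemma continuous_sqdist c : continuous (sqdist c).
Proof.
move=> x; apply: (@continuous_dotp _ _ (fun x => x - c) (fun x => x - c)) => i;
exact: continuous_subr_coord.
Qed.

Lemma dotp_delta (i : 'I_d) x : dotp (delta_mx 0 i) x = x 0 i.
Proof.
rewrite /dotp (bigD1 i)//= big1 ?addr0 => [|j ji]; rewrite !mxE ?eqxx ?mul1r//.
by rewrite (negbTE ji) mul0r.
Qed.

Lemma is_derive_sqdist c x (i : 'I_d) :
  is_derive x (delta_mx 0 i) (sqdist c) (2 * (x 0 i - c 0 i)).
Proof.
have h : is_derive (0 : R) (1 : R) (fun h : R => h ^+ 2 + (2 * (x 0 i - c 0 i)) * h + sqdist c x)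
    (2 * (x 0 i - c 0 i)).
  apply: (@is_derive_eq _ _ _ ((@id R) ^+ 2 + (2 * (x 0 i - c 0 i)) \*: (@id R) + cst (sqdist c x))).
  by rewrite expr1 mulr0 scale0r add0r addr0 [_%:A]mulr1.
have E (k : R) (u : 'rV[R]_d) : dotp (k *: delta_mx 0 i + u) (k *: delta_mx 0 i + u) =
    k ^+ 2 + 2 * u 0 i * k + dotp u u.
  rewrite dotpDr !(dotpC (_ + u)) !dotpDr (dotpC u (k *: _)) !dotpZl.
  by rewrite !dotp_delta !mxE !eqxx/=; ring.
apply: is_derive_line h => h /=; rewrite addr0 [_%:A]mulr1 /sqdist.
by rewrite -[_ *: _ + x - c]addrA E !mxE.
Qed.

(** For [a > 0] it falls from 1 to 0 over the annulus where [a * sqdist c x + b] runs from 0 to 1.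
    One choice of [a] and [b] isolates a singular point, another gives the thin layer inside a
    sphere. *)
Definition radial_step c (a b : R) x : R := step (a * sqdist c x + b).

Definition dradial_step c (a b : R) (i : 'I_d) x : R :=
  dstep (a * sqdist c x + b) * (a * (2 * (x 0 i - c 0 i))).

Lemma continuous_affine_sqdist c a b : continuous (fun x => a * sqdist c x + b).
Proof.
move=> x; apply: (@continuousD _ _ _ (fun x => a * sqdist c x) (cst b)); last exact: cst_continuous.
by apply: (@continuousM _ _ (cst a) (sqdist c)); [exact: cst_continuous|exact: continuous_sqdist].
Qed.

Lemma is_derive_radial_step c a b i x :
  is_derive x (delta_mx 0 i) (radial_step c a b) (dradial_step c a b i x).
Proof.
apply: (@is_derive_comp _ _ (fun x => a * sqdist c x + b) step); last exact: is_derive_step.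
have h := is_derive_sqdist c x i.
apply: (@is_derive_eq _ _ _ (a \*: sqdist c + cst b)).
by rewrite addr0.
Qed.

Lemma continuous_radial_step c a b : continuous (radial_step c a b).
Proof.
move=> x; apply: (@continuous_comp _ _ _ (fun x => a * sqdist c x + b) step).
  exact: continuous_affine_sqdist.
exact: continuous_step.
Qed.

Lemma continuous_dradial_step c a b i : continuous (dradial_step c a b i).
Proof.
move=> x; apply: (@continuousM _ _ (fun x => dstep (a * sqdist c x + b))
  (fun x => a * (2 * (x 0 i - c 0 i)))).
  apply: (@continuous_comp _ _ _ (fun x => a * sqdist c x + b) dstep).
    exact: continuous_affine_sqdist.
  exact: continuous_dstep.
apply: (@continuousM _ _ (cst a) (fun x => 2 * (x 0 i - c 0 i))).
  exact: cst_continuous.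
apply: (@continuousM _ _ (cst 2) (fun x => x 0 i - c 0 i)); first exact: cst_continuous.
apply: (@continuousB _ _ _ (fun x => x 0 i) (cst (c 0 i))).
  exact: continuous_coord_rV.
exact: cst_continuous.
Qed.

End radial_cutoff.

Section Rintegral_lemmas.
Context d (T : measurableType d) {R : realType} (mu : {measure set T -> \bar R}).
Implicit Types (D : set T) (f g : T -> R).

Lemma EFin_Rintegral D f : measurable D -> mu.-integrable D (EFin \o f) ->
  ((\int[mu]_(x in D) f x)%:E = \int[mu]_(x in D) (f x)%:E)%E.
Proof. by move=> mD intf; rewrite /Rintegral fineK//; exact: integrable_fin_num. Qed.

Lemma Rintegral_dominated (D : set T) (f_ : nat -> T -> R) f g : measurable D ->
  (forall n, measurable_fun D (f_ n)) -> measurable_fun D f ->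
  {ae mu, forall x, D x -> f_ n x @[n --> \oo] --> f x} ->
  mu.-integrable D (EFin \o g) -> (forall n x, D x -> `|f_ n x| <= g x) ->
  (\int[mu]_(x in D) f_ n x) @[n --> \oo] --> (\int[mu]_(x in D) f x : R).
Proof.
move=> mD mf_ mf f_f intg f_g.
have h1 : {ae mu, forall x, D x -> (f_ n x)%:E @[n --> \oo] --> (f x)%:E}.
  by apply: filterS f_f => x h Dx; apply: cvg_EFin; [exact: nearW|exact: h].
have h2 : {ae mu, forall x n, D x -> (`|(f_ n x)%:E| <= (g x)%:E)%E}.
  by apply: aeW => x n Dx; rewrite /= lee_fin f_g.
have [intf _ h] := @dominated_convergence _ _ _ mu D mD (fun n x => (f_ n x)%:E)
  (fun x => (f x)%:E) (fun x => (g x)%:E)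
  (fun n => proj2 (measurable_EFinP _ _) (mf_ n)) (proj2 (measurable_EFinP _ _) mf)
  h1 intg h2.
by apply: fine_cvg; rewrite fineK; [exact: h|exact: integrable_fin_num].
Qed.

Lemma Rintegral_vanish D f : (forall x, ~ D x -> f x = 0) ->
  \int[mu]_x f x = \int[mu]_(x in D) f x.
Proof.
move=> f0; rewrite /Rintegral (@integral_vanish _ _ _ _ D)// => x /f0 ->//.
Qed.

Lemma le_Rintegral_cst D f (K : R) : measurable D -> (mu D < +oo)%E ->
  measurable_fun D f -> (forall x, D x -> `|f x| <= K) ->
  `|\int[mu]_(x in D) f x| <= K * fine (mu D).
Proof.
move=> mD Doo mf fK.
have intf := bounded_integrable mD Doo mf fK.
rewrite (le_trans (le_normr_Rintegral mD intf))// -Rintegral_cst//.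
apply: le_Rintegral => //.
  exact: (integrable_abse intf).
apply: (@bounded_integrable _ _ _ _ _ _ `|K|) => //.
Qed.

Lemma bounded_mul_integrable D f g (K : R) : measurable D -> measurable_fun D f ->
  (forall x, D x -> `|f x| <= K) -> mu.-integrable D (EFin \o g) ->
  mu.-integrable D (EFin \o (fun x => f x * g x)).
Proof.
move=> mD mf fK intg.
have -> : EFin \o (fun x => f x * g x) = ((EFin \o f) \* (EFin \o g))%E.
  by apply/funext => x /=; rewrite EFinM.
apply: integrableMr => //.
exists K; split; first exact: num_real.
by move=> y Ky x Dx; apply: le_trans (fK _ Dx) _; exact: ltW.
Qed.

End Rintegral_lemmas.

(** * Fields of bounded support and removable singularities *)

Section divergence_vanishing_field.
Context {R : realType}.

Lemma ler_sum_cst d (f : 'I_d -> R) (K : R) :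
  (forall i, `|f i| <= K) -> `|\sum_(i < d) f i| <= d%:R * K.
Proof.
move=> fK; rewrite (le_trans (ler_norm_sum _ _ _))//.
rewrite (le_trans (ler_sum _ (fun i _ => fK i)))//.
by rewrite sumr_const card_ord mulr_natl.
Qed.

Lemma integral_div0_smooth d (G D : 'I_d -> 'rV[R]_d -> R) (M : R) : 0 < M ->
  (forall i x, is_derive x (delta_mx 0 i) (G i) (D i x)) ->
  (forall i, continuous (D i)) ->
  (forall i x, ~ cube M x -> G i x = 0 /\ D i x = 0) ->
  \int[lebesgue_rV d]_x (\sum_(i < d) D i x) = 0.
Proof.
move=> M0 GD cD G0; rewrite /Rintegral.
under eq_integral do rewrite -sumEFin.
rewrite integral_sum//= => [|i].
  by rewrite big1// => i _; rewrite (integral_partial0 M0 (GD i) (cD i) (G0 i)).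
have [K K0 DK] := compact_bound (@compact_cube _ _ M) (fun x _ => cD i x).
apply: (@bounded_support_integrable _ _ _ M K).
- exact: continuous_measurable_rV.
- move=> x; have [/DK //|/(G0 i)[_ ->]] := pselect (cube M x).
  by rewrite normr0.
- by move=> x /(G0 i)[].
Qed.

Lemma enorm_lt_sqdist d (c x : 'rV[R]_d) (r : R) : 0 < r ->
  (enorm (c - x) < r) = (sqdist c x < r ^+ 2).
Proof. by move=> r0; rewrite enormB enorm_lt_sqrt//. Qed.

Lemma continuous_near0 (T : topologicalType) (f : T -> R) x :
  (\forall y \near x, f y = 0) -> {for x, continuous f}.
Proof.
move=> f0; have -> : {for x, continuous f} = (f y @[y --> x] --> f x) by [].
by rewrite (nbhs_singleton f0); exact: cvg_near_cst.
Qed.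

Lemma sqdistxx d (c : 'rV[R]_d) : sqdist c c = 0.
Proof. by rewrite /sqdist subrr -sqr_enorm -(scale0r (0 : 'rV[R]_d)) enormZ normr0 mul0r expr0n. Qed.

(* A point is removable for a bounded field in dimension at least 2: cutting
   off a ball of radius [e] costs [O(e ^ d / e)]. *)
Lemma integral_div0 d (Z : seq 'rV[R]_d) (G D : 'I_d -> 'rV[R]_d -> R) (M K : R) :
  0 < M -> (forall i, measurable_fun setT (G i)) ->
  (forall i x, x \notin Z -> is_derive x (delta_mx 0 i) (G i) (D i x)) ->
  (forall i x, x \notin Z -> {for x, continuous (G i)}) ->
  (forall i x, x \notin Z -> {for x, continuous (D i)}) ->
  (forall i x, `|G i x| <= K) ->
  (forall i x, ~ cube M x -> G i x = 0 /\ D i x = 0) ->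
  (lebesgue_rV d).-integrable setT (EFin \o (fun x => \sum_(i < d) D i x)) ->
  (Z = [::] \/ 1 < d)%N ->
  \int[lebesgue_rV d]_x (\sum_(i < d) D i x) = 0.
Proof.
move=> M0; elim: Z G D => [|z Z IH] G D mG GD cG cD GK G0 intD Zd.
  apply: (integral_div0_smooth M0 (G := G)) => //.
  - by move=> i x; exact: GD.
  - by move=> i x; exact: cD.
have {Zd} d1 : (1 < d)%N by case: Zd.
(* With this scale [psi n] vanishes up to distance 1/(n+1) from [z] and is 1 from distance sqrt 2 /
   (n+1) on, hence off the ball [B n] of radius 2/(n+1). *)
pose a n : R := n.+1%:R ^+ 2.
pose psi n (x : 'rV[R]_d) : R := 1 - radial_step z (a n) (-1) x.
pose dpsi n i x := - dradial_step z (a n) (-1) i x.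
pose Gn n i x := psi n x * G i x.
pose Dn n i x := psi n x * D i x + dpsi n i x * G i x.
have cpsi n : continuous (psi n).
  move=> x; apply: (@continuousB R R _ (fun=> 1 : R) (radial_step z (a n) (-1))).
    exact: cst_continuous.
  exact: continuous_radial_step.
have cdpsi n i : continuous (dpsi n i).
  by move=> x; apply: continuousN; exact: continuous_dradial_step.
have psi01 n x : 0 <= psi n x <= 1.
  by rewrite subr_ge0 step_le1 gerBl step_ge0.
have psiK n x : `|psi n x| <= 1 by have /andP[? ?] := psi01 n x; rewrite ger0_norm.
have psi_z n : \forall y \near z, psi n y = 0 /\ forall i, dpsi n i y = 0.
  have : \forall y \near z, a n * sqdist z y + (-1) < 0.
    have /cvgr_lt := @continuous_affine_sqdist _ _ z (a n) (-1) z; apply.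
    by rewrite sqdistxx mulr0 add0r oppr_lt0.
  apply: filterS => y /ltW y0; split=> [|i].
    by rewrite /psi /radial_step step_le0// subrr.
  by rewrite /dpsi /dradial_step dstep_le0// mul0r oppr0.
have mpsi n : measurable_fun setT (psi n) by exact: continuous_measurable_rV.
have mdpsi n i : measurable_fun setT (dpsi n i) by exact: continuous_measurable_rV.
pose B n := eball z (2 / n.+1%:R).
have n0 n : 0 < n.+1%:R :> R by [].
have dpsi0 n i x : ~ B n x -> dpsi n i x = 0.
  move=> /negP; rewrite enorm_lt_sqdist ?divr_gt0// -leNgt => Bx.
  rewrite /dpsi /dradial_step dstep_ge1 ?mul0r ?oppr0// lerBrDr.
  have : a n * (2 / n.+1%:R) ^+ 2 <= a n * sqdist z x by rewrite ler_wpM2l// exprn_ge0.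
  apply: le_trans; rewrite /a -exprMn mulrC divfK ?gt_eqF// expr2.
  by rewrite -natrM -(natrD R 1 1) ler_nat.
(* [16 = 4 * 2 * 2]: 4 bounds [dstep], one 2 comes from differentiating the square, the other from
   the radius 2/(n+1) of [B n], which also cancels one factor n+1 of [a n]. *)
have dpsiK n i x : `|dpsi n i x| <= 16 * n.+1%:R.
  have [Bx|/dpsi0 ->] := pselect (B n x); last by rewrite normr0 mulr_ge0.
  rewrite normrN /dradial_step normrM.
  have -> : 16 * n.+1%:R = 4 * (a n * (2 * (2 / n.+1%:R))) :> R.
    by rewrite /a; field; rewrite gt_eqF.
  apply: ler_pM => //; first exact: dstep_bound.
  have a0 : 0 <= a n by rewrite exprn_ge0.
  rewrite normrM (ger0_norm a0) ler_wpM2l// normrM ger0_norm// ler_wpM2l//.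
  have := coord_le_enorm (z - x) i; rewrite !mxE distrC => /le_trans; apply.
  exact: ltW.
have sumK n x : `|\sum_(i < d) dpsi n i x * G i x| <= d%:R * (16 * n.+1%:R * K).
  apply: ler_sum_cst => i; rewrite normrM; apply: ler_pM; rewrite ?normr_ge0//.
have msum n : measurable_fun setT (fun x => \sum_(i < d) dpsi n i x * G i x).
  by apply: measurable_sum => i; exact: measurable_funM.
have int2 n : (lebesgue_rV d).-integrable setT
    (EFin \o (fun x => \sum_(i < d) dpsi n i x * G i x)).
  apply: (@bounded_support_integrable _ _ _ M _ (msum n) (sumK n)) => x xM.
  by rewrite big1// => i _; have [-> _] := G0 i x xM; rewrite mulr0.
have int1 n : (lebesgue_rV d).-integrable setT
    (EFin \o (fun x => psi n x * \sum_(i < d) D i x)).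
  by apply: (@bounded_mul_integrable _ _ _ _ _ _ _ 1).
have DnE n x : \sum_(i < d) Dn n i x =
    psi n x * (\sum_(i < d) D i x) + \sum_(i < d) dpsi n i x * G i x.
  by rewrite /Dn big_split/= mulr_sumr.
(* As [psi n] vanishes near [z], the field [psi n * G] is regular there, and only the points of the
   shorter list [Z] remain singular. *)
have E0 n : \int[lebesgue_rV d]_x (\sum_(i < d) Dn n i x) = 0.
  apply: (IH (Gn n)) => //.
  - by move=> i; exact: measurable_funM.
  - move=> i x xZ; have [->|xz] := eqVneq x z.
      have [psi0 dpsi0z] := nbhs_singleton (psi_z n).
      rewrite /Dn psi0 dpsi0z !mul0r addr0; apply: is_derive_near0.
      by apply: filterS (psi_z n) => y [y0 _]; rewrite /Gn y0 mul0r.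
    have xzZ : x \notin z :: Z by rewrite inE negb_or xz.
    have h1 : is_derive x (delta_mx 0 i) (psi n) (dpsi n i x).
      have := is_deriveB (is_derive_cst (1 : R) x _)
        (is_derive_radial_step z (a n) (-1) i x).
      by rewrite sub0r.
    have := is_deriveM h1 (GD i x xzZ).
    suff -> : Dn n i x = psi n x *: D i x + G i x *: dpsi n i x by [].
    by rewrite /Dn (mulrC (dpsi _ _ _)).
  - move=> i x xZ; have [->|xz] := eqVneq x z.
      apply: continuous_near0.
      by apply: filterS (psi_z n) => y [y0 _]; rewrite /Gn y0 mul0r.
    apply: (@continuousM _ _ (psi n) (G i)); first exact: cpsi.
    by apply: cG; rewrite inE negb_or xz.
  - move=> i x xZ; have [->|xz] := eqVneq x z.
      apply: continuous_near0.
      by apply: filterS (psi_z n) => y [y0 dy0]; rewrite /Dn y0 dy0 !mul0r addr0.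
    have xzZ : x \notin z :: Z by rewrite inE negb_or xz.
    apply: (@continuousD _ _ _ (fun x => psi n x * D i x) (fun x => dpsi n i x * G i x)).
      by apply: (@continuousM _ _ (psi n) (D i)); [exact: cpsi|exact: cD].
    by apply: (@continuousM _ _ (dpsi n i) (G i)); [exact: cdpsi|exact: cG].
  - move=> i x; rewrite normrM -[leRHS]mul1r; apply: ler_pM; rewrite ?normr_ge0//.
  - by move=> i x /(G0 i)[G0x D0x]; rewrite /Gn /Dn G0x D0x !mulr0 addr0.
  - under eq_fun do rewrite DnE.
    exact: (integrableD _ (int1 n) (int2 n)).
  - by right.
pose I n := \int[lebesgue_rV d]_x (psi n x * \sum_(i < d) D i x).
have IE n : I n = - \int[lebesgue_rV d]_x (\sum_(i < d) dpsi n i x * G i x).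
  apply/eqP; rewrite -addr_eq0 -(RintegralD measurableT (int1 n) (int2 n)).
  by apply/eqP; rewrite -[RHS](E0 n); apply: eq_Rintegral => x _; rewrite DnE.
have [V VE] : exists V : R, lebesgue_rV d (eball 0 1) = V%:E.
  by exists (fine (lebesgue_rV d (eball 0 1))); rewrite fineK// fin_eball.
have V0 : 0 <= V by rewrite -lee_fin -VE.
pose C := d%:R * (16 * K) * (2 ^+ d * V).
have Ibound n : `|I n| <= C * n.+1%:R^-1.
  rewrite IE normrN (@Rintegral_vanish _ _ _ _ (B n)); last first.
    by move=> x Bx; rewrite big1// => i _; rewrite dpsi0// mul0r.
  have BE : fine (lebesgue_rV d (B n)) = (2 / n.+1%:R) ^+ d * V.
    by rewrite /B lebesgue_eball_scale ?divr_gt0// VE.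
  have := le_Rintegral_cst (measurable_eball _ _) (eball_lty _ _)
    (measurable_funTS (msum n)) (fun x _ => sumK n x) : _ <= _ * fine (lebesgue_rV d (B n)).
  rewrite BE => /le_trans; apply; rewrite exprMn exprVn /C.
  (* Here [1 < d] enters: the volume of [B n] is of order (n+1)^-d, so at most of order (n+1)^-2,
     and beats the factor n+1 in the gradient of the cutoff. *)
  have nV : n.+1%:R ^- d <= n.+1%:R^-1 * n.+1%:R^-1 :> R.
    rewrite -expr2 -exprVn ler_wiXn2l ?invr_ge0// invf_le1//.
    by rewrite (ler_nat R 1).
  have -> : d%:R * (16 * K) * (2 ^+ d * V) / n.+1%:R =
    d%:R * (16 * n.+1%:R * K) * (2 ^+ d * (n.+1%:R^-1 * n.+1%:R^-1) * V).
    by field; rewrite gt_eqF.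
  have K0 : 0 <= K := le_trans (normr_ge0 _) (GK (Ordinal (ltnW d1)) 0).
  by rewrite ler_wpM2l ?mulr_ge0// ler_wpM2r// ler_wpM2l ?exprn_ge0.
have I0 : I n @[n --> \oo] --> (0 : R).
  apply: (@squeeze_cvgr _ _ _ _ (fun n => - (C * n.+1%:R^-1)) (fun n => C * n.+1%:R^-1)).
  - by apply: nearW => n; rewrite -ler_norml.
  - rewrite -oppr0 -(mulr0 C); apply: cvgN.
    by apply: cvgM; [exact: cvg_cst|exact: cvg_harmonic].
  - rewrite -(mulr0 C).
    by apply: cvgM; [exact: cvg_cst|exact: cvg_harmonic].
have Ilim : I n @[n --> \oo] --> (\int[lebesgue_rV d]_x (\sum_(i < d) D i x) : R).
  have mD : measurable_fun setT (fun x => \sum_(i < d) D i x).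
    by apply/measurable_EFinP; case/integrableP : intD.
  apply: (@Rintegral_dominated _ _ _ _ _ _ _ (fun x => `|\sum_(i < d) D i x|)) => //.
  - by move=> n; exact: measurable_funM.
  (* Off the null set of the single point [z] the sequence is eventually constant, since
     [a n * sqdist z x >= 2] for large n. *)
  - exists [set z]; split; first exact: measurable_set1_rV.
      by apply: lebesgue_rV_set1; exact: ltnW.
    move=> x /= h; apply: contrapT => /eqP xz; apply: h => _.
    have s0 : 0 < sqdist z x.
      rewrite lt_def dotp_ge0 andbT /sqdist -sqr_enorm sqrf_eq0 enorm_eq0 subr_eq0.
      exact: xz.
    apply: cvg_near_cst; near=> n.
    rewrite /psi /radial_step step_ge1 ?subr0 ?mul1r// lerBrDr.
    rewrite -ler_pdivrMr//.
    have h1 : 2 / sqdist z x <= n.+1%:R.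
      rewrite (@le_trans _ _ n%:R) ?ler_nat//.
      by near: n; exact: nbhs_infty_ger.
    rewrite (le_trans h1)// /a expr2 ler_peMr//.
    by rewrite (ler_nat R 1).
  - exact: (integrable_abse intD).
  - by move=> n x _; rewrite normrM ler_piMl.
exact: (cvg_unique _ Ilim I0).
Unshelve. all: by end_near. Qed.

End divergence_vanishing_field.

(** * The divergence theorem on a ball *)

Section change_of_variables.
Context {R : realType}.

Lemma integral_mscale dT (T : measurableType dT) (mu : {measure set T -> \bar R})
    (D : set T) (k : {nonneg R}) (f : T -> \bar R) : measurable D ->
  mu.-integrable D f ->
  (\int[mscale k mu]_(x in D) f x = k%:num%:E * \int[mu]_(x in D) f x)%E.
Proof.
move=> mD intf; have mf := measurable_int _ intf.
have h := integrable_neg_fin_num mD intf.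
have h' : (\int[mu]_(x in D) f^\+ x +? - \int[mu]_(x in D) f^\- x)%E.
  by apply: fin_num_adde_defl; rewrite fin_numN.
rewrite [LHS]integralE (ge0_integral_mscale _ mD k (measurable_funepos mf))//.
rewrite (ge0_integral_mscale _ mD k (measurable_funeneg mf))//.
by rewrite -(muleBr _ h')// -integralE.
Qed.

Lemma Rintegral_mscale dT (T : measurableType dT) (mu : {measure set T -> \bar R})
    (D : set T) (k : {nonneg R}) (f : T -> R) : measurable D ->
  mu.-integrable D (EFin \o f) ->
  \int[mscale k mu]_(x in D) f x = k%:num * \int[mu]_(x in D) f x.
Proof.
move=> mD intf; rewrite /Rintegral integral_mscale// fineM//.
exact: integrable_fin_num.
Qed.

Lemma Rintegral_affine d (c : 'rV[R]_d) (k : R) (f : 'rV[R]_d -> R) : 0 < k ->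
  measurable_fun setT f ->
  (lebesgue_rV d).-integrable setT (EFin \o (fun x => f (c + k *: x))) ->
  \int[lebesgue_rV d]_x f x = k ^+ d * \int[lebesgue_rV d]_x f (c + k *: x).
Proof.
move=> k0 mf intf; pose mT := measurable_affine_rV c k.
have kd : 0 <= k ^+ d by rewrite exprn_ge0// ltW.
have -> : \int[lebesgue_rV d]_x f x =
    \int[mscale (NngNum kd) (pushm (lebesgue_rV d) mT)]_x f x.
  rewrite /Rintegral; congr fine; apply: eq_measure_integral => A mA _.
  exact: (esym (lebesgue_rV_affine c k0 mA)).
have mf' : measurable_fun setT (EFin \o f) by apply/measurable_EFinP.
rewrite Rintegral_mscale//=; last exact: integrable_pushforward.
by congr (_ * fine _); rewrite integral_pushforward.
Qed.

(** A derivative at the dilation factor 1 taken along 1 + 1/(n+1): a sequence, as dominated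
    convergence requires. *)
Lemma derive_sequence (f : R -> R) (df : R) : is_derive (1 : R) (1 : R) f df ->
  n.+1%:R * (f (1 + n.+1%:R^-1) - f 1) @[n --> \oo] --> df.
Proof.
move=> [dv <-].
have /cvgr_dnbhsP/(_ (fun n => n.+1%:R^-1)) :
  (fun h : R => h^-1 *: ((f \o shift 1) (h *: (1 : R)) - f 1)) @ 0^' --> 'D_1 f 1 by [].
have h0 : (forall n, n.+1%:R^-1 != 0 :> R) /\ n.+1%:R^-1 @[n --> \oo] --> (0 : R).
  by split => [n|]; [rewrite invr_eq0|exact: cvg_harmonic].
move=> /(_ h0); apply: cvg_trans; apply: near_eq_cvg; apply: nearW => n /=.
by rewrite invrK [_%:A]mulr1 (addrC _ 1).
Qed.

End change_of_variables.

(** * Dilation of radial cutoffs *)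

Section radial_mean.
Context {R : realType} {d : nat}.
Implicit Types (c x : 'rV[R]_d).

Lemma sqdist_dilate c (u : R) x : sqdist c (c + u *: (x - c)) = u ^+ 2 * sqdist c x.
Proof. by rewrite /sqdist addrC addKr dotpZl dotpZr; ring. Qed.

(* Both sides are [- d/du] at [u = 1] of
   [\int radial_step c (a * u ^+ 2) b * gamma = u ^- d * \int radial_step c a b * gamma]. *)
Lemma radial_mean c (a b rho : R) (gamma : 'rV[R]_d -> R) (K : R) :
  0 < rho -> 0 < a -> 1 <= a * rho ^+ 2 + b ->
  measurable_fun setT gamma -> (forall x, `|gamma x| <= K) ->
  (forall u x, 0 < u -> gamma (c + u *: (x - c)) = gamma x) ->
  \int[lebesgue_rV d]_x
    (- (2 * (a * sqdist c x) * dstep (a * sqdist c x + b)) * gamma x) =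
  d%:R * \int[lebesgue_rV d]_x (radial_step c a b x * gamma x).
Proof.
move=> rho0 a0 ab mg gK gh; pose B := eball c rho.
have K0 : 0 <= K := le_trans (normr_ge0 _) (gK 0).
have ms : measurable_fun setT (sqdist c) by apply: continuous_measurable_rV; exact: continuous_sqdist.
have outB x : ~ B x -> forall u, 1 <= u -> 1 <= a * (u ^+ 2 * sqdist c x) + b.
  move=> /negP; rewrite enorm_lt_sqdist// -leNgt => Bx u u1.
  rewrite (le_trans ab)// lerD2r ler_pM2l// (le_trans Bx)// ler_peMl ?dotp_ge0//.
  by rewrite exprn_ege1.
(* Factors at least 1 shrink the support of the dilated cutoff, so that all integrands below vanish
   off the same ball [B]. *)
pose U n : R := 1 + n.+1%:R^-1.
have U1 n : 1 <= U n by rewrite lerDl invr_ge0.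
have U0 n : 0 < U n by rewrite (lt_le_trans ltr01).
pose f x := radial_step c a b x * gamma x.
pose fu n x := step (a * (U n ^+ 2 * sqdist c x) + b) * gamma x.
(* Since [gamma] is invariant under dilations, the dilation acts on the cutoff alone. *)
have fuE n x : fu n x = f ((c - U n *: c) + U n *: x).
  have -> : (c - U n *: c) + U n *: x = c + U n *: (x - c).
    by rewrite scalerBr -addrA; congr (_ + _); rewrite addrC.
  by rewrite /f gh// /radial_step sqdist_dilate.
have f0 x : ~ B x -> f x = 0.
  move=> /outB/(_ 1 (lexx _)); rewrite expr1n mul1r => h.
  by rewrite /f /radial_step step_ge1// mul0r.
have fu0 n x : ~ B x -> fu n x = 0.
  by move=> /outB/(_ _ (U1 n)) h; rewrite /fu step_ge1// mul0r.
have mstep : measurable_fun setT (@step R).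
  by apply: continuous_measurable_fun; exact: continuous_step.
have mf : measurable_fun setT f.
  apply: measurable_funM => //.
  by apply: continuous_measurable_rV; exact: continuous_radial_step.
have mfu n : measurable_fun setT (fu n).
  apply: measurable_funM => //; apply: measurableT_comp => //.
  by apply: measurable_funD => //; do 2 apply: measurable_funM => //.
have step1 (s : R) : `|step s| <= 1 by rewrite ger0_norm ?step_ge0// step_le1.
have fK x : `|f x| <= K by rewrite normrM -[K]mul1r ler_pM// step1.
have fuK n x : `|fu n x| <= K by rewrite normrM -[K]mul1r ler_pM// step1.
have intf : (lebesgue_rV d).-integrable setT (EFin \o f).
  apply: (@bounded_support_integrable _ _ _ (enorm c + rho) K) => // x xM.
  by apply: f0 => /eball_sub_cube.
have intfu n : (lebesgue_rV d).-integrable setT (EFin \o fu n).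
  apply: (@bounded_support_integrable _ _ _ (enorm c + rho) K) => // x xM.
  by apply: fu0 => /eball_sub_cube.
pose J := \int[lebesgue_rV d]_x f x.
have JE n : J = U n ^+ d * \int[lebesgue_rV d]_x fu n x.
  rewrite /J (Rintegral_affine (c := c - U n *: c) (U0 n))//.
    by congr (_ * _); apply: eq_Rintegral => x _; rewrite fuE.
  by under eq_fun do rewrite /= -fuE; exact: intfu.
(* Minus the difference quotient in the dilation factor. The limit of its integral is found twice:
   by scaling, from the derivative of [u ^ -d] at 1, and by differentiating under the integral
   sign. *)
pose q n x := n.+1%:R * (f x - fu n x).
pose w x := - (2 * (a * sqdist c x) * dstep (a * sqdist c x + b)) * gamma x.
have mw : measurable_fun setT w.
  have m1 : measurable_fun setT (fun x => a * sqdist c x) by exact: measurable_funM.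
  have mdstep : measurable_fun setT (@dstep R).
    by apply: continuous_measurable_fun; exact: continuous_dstep.
  apply: measurable_funM => //; apply: measurable_funN.
  apply: measurable_funM; first exact: measurable_funM.
  by apply: measurableT_comp => //; exact: measurable_funD.
have qE n : \int[lebesgue_rV d]_(x in B) q n x =
    J * - (n.+1%:R * ((U n ^+ d)^-1 - (1 ^+ d)^-1)).
  rewrite -Rintegral_vanish => [|x Bx]; last by rewrite /q f0// fu0// subrr mulr0.
  rewrite /q RintegralZl//; last exact: (integrableB _ intf (intfu n)).
  have Ud : U n ^+ d != 0 by rewrite expf_neq0// gt_eqF.
  have Fu : \int[lebesgue_rV d]_x fu n x = J / U n ^+ d by rewrite (JE n) mulrAC mulfV// mul1r.
  rewrite RintegralB//; first by rewrite Fu -/J expr1n invr1; ring.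
have lim1 : \int[lebesgue_rV d]_(x in B) q n x @[n --> \oo] --> (J * d%:R : R).
  under eq_cvg do rewrite qE.
  apply: cvgM; first exact: cvg_cst.
  rewrite -[X in _ --> X]opprK; apply: cvgN.
  apply: (@derive_sequence _ (fun u => (u ^+ d)^-1)).
  have h : is_derive (1 : R) (1 : R) (fun u : R => u ^+ d) d%:R.
    have -> : (fun u : R => u ^+ d) = (@id R) ^+ d.
      by apply/funext => u; rewrite exprfctE.
    by apply: is_derive_eq; rewrite expr1n mulr1 [_%:A]mulr1.
  have := @is_deriveV _ (fun u : R => u ^+ d) _ _ _ _ h.
  by rewrite !expr1n invr1 scaleN1r; apply; exact: oner_neq0.
have lim2 : \int[lebesgue_rV d]_(x in B) q n x @[n --> \oo] -->
    (\int[lebesgue_rV d]_(x in B) w x : R).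
  have mB : measurable B by exact: measurable_eball.
  (* [12 = 4 * 3]: [step] is Lipschitz with constant 4, and n+1 times [U n ^ 2 - 1] equals 2 +
     1/(n+1), at most 3. *)
  apply: (@Rintegral_dominated _ _ _ _ _ _ _ (cst (12 * (a * rho ^+ 2) * K))) => //.
  - move=> n; apply: measurable_funTS; apply: measurable_funM => //.
    exact: measurable_funB.
  - exact: measurable_funTS.
  - apply: aeW => x _; pose s := a * sqdist c x.
    have hs : is_derive (1 : R) (1 : R) (fun u : R => step (s * u ^+ 2 + b))
        (dstep (s + b) * (2 * s)).
      have h1 : is_derive (1 : R) (1 : R) (fun u : R => s * u ^+ 2 + b) (2 * s).
        apply: (@is_derive_eq _ _ _ (s \*: ((@id R) ^+ 2) + cst b)).
        by rewrite expr1 addr0 mulr1 [_%:A]mulr1 [_ *: _]mulrC.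
      have h2 := is_derive_step (s * 1 ^+ 2 + b).
      have := is_derive_comp h1 h2.
      by rewrite expr1n mulr1.
    have := derive_sequence hs; rewrite expr1n mulr1 => h.
    have -> : w x = - (dstep (s + b) * (2 * s)) * gamma x by rewrite /w -/s; ring.
    have -> : (fun n => q n x) = (fun n => - (n.+1%:R *
        (step (s * (1 + n.+1%:R^-1) ^+ 2 + b) - step (s + b))) * gamma x).
      apply/funext => n; rewrite /q /fu /f /radial_step -/(U n) /s.
      have -> : a * (U n ^+ 2 * sqdist c x) = a * sqdist c x * U n ^+ 2 by ring.
      by ring.
    exact: (cvgM (cvgN h) (cvg_cst (gamma x))).
  - apply: (@bounded_integrable _ _ _ _ _ _ `|12 * (a * rho ^+ 2) * K|) => //.
    exact: eball_lty.
  - move=> n x Bx; rewrite /q /fu /f /radial_step -mulrBl (mulrA n.+1%:R) normrM ler_pM//.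
    have s0 : 0 <= sqdist c x by exact: dotp_ge0.
    have sr : sqdist c x <= rho ^+ 2 by rewrite ltW// -enorm_lt_sqdist.
    have n0 : 0 < n.+1%:R :> R by [].
    rewrite normrM gtr0_norm//.
    have /(ler_wpM2l (ltW n0))/le_trans := step_lipschitz
      (a * sqdist c x + b) (a * (U n ^+ 2 * sqdist c x) + b).
    apply.
    have -> : a * sqdist c x + b - (a * (U n ^+ 2 * sqdist c x) + b) =
      - (a * sqdist c x * (U n ^+ 2 - 1)) by ring.
    have U2 : 0 <= U n ^+ 2 - 1 by rewrite subr_ge0 exprn_ege1.
    have a0' := ltW a0.
    rewrite normrN ger0_norm ?mulr_ge0//.
    have -> : n.+1%:R * (4 * (a * sqdist c x * (U n ^+ 2 - 1))) =
      4 * (2 + n.+1%:R^-1) * (a * sqdist c x) by rewrite /U; field; rewrite gt_eqF.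
    apply: ler_pM; rewrite ?mulr_ge0 ?addr_ge0//; last by rewrite ler_pM2l.
    have -> : 12 = 4 * 3 :> R by ring.
    rewrite ler_pM2l// -[leRHS]/(2 + 1)%:R natrD lerD2l invf_le1//.
    by rewrite (ler_nat R 1).
rewrite (@Rintegral_vanish _ _ _ _ B) => [|x Bx]; last first.
  have := outB x Bx 1 (lexx _); rewrite expr1n mul1r => /dstep_ge1 h.
  by rewrite h mulr0 oppr0 mul0r.
by rewrite (cvg_unique _ lim2 lim1)// -/J mulrC.
Qed.

End radial_mean.

(** * Radial projection and the neighbourhood of a sphere *)

Section sphere_layer.
Context {R : realType} {d : nat}.
Implicit Types (c x y : 'rV[R]_d) (r : R).

Lemma normalizeZ (u : R) x : 0 < u -> normalize (u *: x) = normalize x.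
Proof.
move=> u0; rewrite /normalize enormZ gtr0_norm// scalerA invfM mulrAC mulVf ?gt_eqF//.
by rewrite mul1r.
Qed.

Lemma normalize0 : normalize (0 : 'rV[R]_d) = 0.
Proof. exact: scaler0. Qed.

Lemma enorm_gt0 x : (0 < enorm x) = (x != 0).
Proof. by rewrite lt_def enorm_ge0 andbT enorm_eq0. Qed.

Lemma enorm_normalize x : x != 0 -> enorm (normalize x) = 1.
Proof.
move=> x0; rewrite enormZ ger0_norm ?invr_ge0 ?enorm_ge0// mulVf//.
by rewrite enorm_eq0.
Qed.

Lemma radial_proj_dilate c r (u : R) x : 0 < u ->
  radial_proj c r (c + u *: (x - c)) = radial_proj c r x.
Proof. by move=> u0; rewrite /radial_proj [c + u *: _ - c]addrC addKr normalizeZ. Qed.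

(** Because [normalize] fixes 0, the centre is the one point not sent to the sphere. Bounds for
    functions composed with [radial_proj] therefore treat it apart. *)
Lemma radial_proj_center c r : radial_proj c r c = c.
Proof. by rewrite /radial_proj subrr normalize0 scaler0 addr0. Qed.

Lemma radial_proj_esphere c r x : 0 < r -> x != c -> esphere c r (radial_proj c r x).
Proof.
move=> r0 xc; rewrite /esphere/= /radial_proj enormB addrC addKr enormZ.
by rewrite enorm_normalize ?subr_eq0// mulr1 gtr0_norm.
Qed.

Lemma radial_projK c r x : 0 < r ->
  x = c + (enorm (x - c) / r) *: (radial_proj c r x - c).
Proof.
move=> r0; have [->|xc] := eqVneq x c.
  by rewrite radial_proj_center subrr scaler0 addr0.
rewrite /radial_proj addrC [c + r *: _]addrC addrK scalerA divfK ?gt_eqF//.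
rewrite /normalize scalerA mulfV ?enorm_eq0 ?subr_eq0// scale1r.
by rewrite subrK.
Qed.

Lemma sqdist_esphere c r y : esphere c r y -> sqdist c y = r ^+ 2.
Proof. by rewrite /esphere/= enormB => <-; rewrite sqr_enorm. Qed.

Lemma compact_esphere c r : compact (esphere c r).
Proof.
apply: (@subclosed_compact _ _ (cube (enorm c + r))).
- have -> : esphere c r = (fun x => enorm (c - x)) @^-1` [set r] by [].
  apply: preimage_closed; last exact: closed_eq.
  move=> x _; apply: (@continuous_enorm _ _ (fun x => c - x)) => i.
  exact: continuous_subl_coord.
- exact: compact_cube.
- move=> x; rewrite /esphere/= => xr i.
  have := ler_normB (c ord0 i) (c ord0 i - x ord0 i).
  rewrite subKr => /le_trans; apply; rewrite lerD ?coord_le_enorm// -xr.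
  by have := coord_le_enorm (c - x) i; rewrite !mxE.
Qed.

(** Continuity of [k] is given only at the points of the sphere, so the local estimates are made
    uniform by compactness of the sphere, in its near-covering form. *)
Lemma sphere_layer c r (k : 'rV[R]_d -> R) (e : R) : 0 < e ->
  (forall y, esphere c r y -> {for y, continuous k}) ->
  \forall n \near \oo, forall y (tau : R), esphere c r y ->
    `|tau - 1| <= n.+1%:R^-1 -> `|k (c + tau *: (y - c)) - k y| <= e.
Proof.
move=> e0 ck.
pose P (n : nat) y := forall tau : R,
  `|tau - 1| <= n.+1%:R^-1 -> `|k (c + tau *: (y - c)) - k y| <= e.
have /compact_near_coveringP/(_ nat \oo P _) : compact (esphere c r).
  exact: compact_esphere.
have h : forall y, esphere c r y -> \forall y' \near y & n \near \oo, forall tau : R,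
    `|tau - 1| <= n.+1%:R^-1 -> `|k (c + tau *: (y' - c)) - k y'| <= e.
  move=> y Sy; have /cvgrPdist_lt/(_ (e / 2) (divr_gt0 e0 (ltr0Sn R 1))) := ck _ Sy.
  move=> /near_rV[del del0 H].
  (* Half of [del] covers the distance from [y] to [y'], the other half the radial displacement of
     [y'], which is at most (|r| + del) / (n+1) in each coordinate. *)
  exists ([set y' : 'rV[R]_d | forall i, `|y 0 i - y' 0 i| < del / 2],
    [set n | (`|r| + del) * n.+1%:R^-1 < del / 2]).
    split => /=.
      by apply/near_rV; exists (del / 2); [rewrite divr_gt0|].
    have /cvgr_lt : (`|r| + del) * n.+1%:R^-1 @[n --> \oo] --> (`|r| + del) * 0.
      by apply: cvgM; [exact: cvg_cst|exact: cvg_harmonic].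
    by apply; rewrite mulr0 divr_gt0.
  move=> [y' n] /= [yy' nd] tau htau.
  have close (z : 'rV[R]_d) : (forall i, `|y 0 i - z 0 i| < del) -> `|k z - k y| <= e / 2.
    by move=> /H h; rewrite distrC ltW.
  have h1 : `|k y' - k y| <= e / 2.
    apply: close => i; apply: lt_trans (yy' i) _.
    by rewrite ltr_pdivrMr// ltr_pMr// ltr1n.
  have h2 : `|k (c + tau *: (y' - c)) - k y| <= e / 2.
    apply: close => i.
    have -> : c + tau *: (y' - c) = y' + (tau - 1) *: (y' - c).
      rewrite scalerBl scale1r [RHS]addrCA opprB (addrC y' (c - y')) subrK.
      exact: addrC.
    rewrite !mxE opprD addrA (le_lt_trans (ler_normB _ _))// (splitr del).
    rewrite ltr_leD//.
    rewrite normrM (le_trans _ (ltW nd))// mulrC.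
    apply: ler_pM => //.
    have cy : `|c 0 i - y 0 i| <= `|r|.
      rewrite -Sy [leRHS]ger0_norm ?enorm_ge0//.
      by have := coord_le_enorm (c - y) i; rewrite !mxE.
    have := ler_distD (y 0 i) (y' 0 i) (c 0 i); rewrite (distrC (y' 0 i) (y 0 i)) (distrC (y 0 i) (c 0 i)).
    move=> /le_trans; apply; rewrite addrC lerD//.
    rewrite (le_trans (ltW (yy' i)))//.
    by rewrite ler_pdivrMr// ler_pMr// ler1n.
  have := ler_distD (k y) (k (c + tau *: (y' - c))) (k y').
  rewrite (distrC (k y)) => /le_trans; apply.
  by rewrite (splitr e) lerD.
move=> /(_ h); apply: filterS => n H y tau Sy; exact: H.
Qed.

End sphere_layer.

(** * Flux through a sphere and divergence in the ball *)

Section divergence_ball.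
Context {R : realType} {d : nat}.
Implicit Types (c x y : 'rV[R]_d) (r : R).

(** On the sphere of radius [r] about [c] this is the outward normal component of [F] divided by
    [r]. Dividing by the squared distance makes the weight in front of it, in the gradient term of a
    cutoff, the one of [radial_mean]. *)
Definition flux c (F : 'rV[R]_d -> 'rV[R]_d) y : R :=
  dotp (F y) (y - c) / sqdist c y.

Lemma measurable_coord_fun (F : 'rV[R]_d -> 'rV[R]_d) i :
  measurable_fun setT F -> measurable_fun setT (fun x => F x 0 i).
Proof. by move=> mF; exact: measurableT_comp (measurable_coord_rV i) mF. Qed.

Lemma measurable_dotp dT (T : measurableType dT) (F G : T -> 'rV[R]_d) :
  measurable_fun setT F -> measurable_fun setT G ->
  measurable_fun setT (fun t => dotp (F t) (G t)).
Proof.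
move=> mF mG; apply: measurable_sum => i; apply: measurable_funM.
  exact: (measurableT_comp (measurable_coord_rV i) mF).
exact: (measurableT_comp (measurable_coord_rV i) mG).
Qed.

Lemma measurable_subr_rV c : measurable_fun setT (fun x => x - c).
Proof.
apply: measurable_fun_rV => i; under eq_fun do rewrite !mxE.
by apply: measurable_funB; [exact: measurable_coord_rV|exact: measurable_cst].
Qed.

Lemma measurable_sqdist c : measurable_fun setT (sqdist c).
Proof. by apply: measurable_dotp; exact: measurable_subr_rV. Qed.

Lemma measurable_ge0_inv dT (T : measurableType dT) (f : T -> R) :
  measurable_fun setT f -> (forall t, 0 <= f t) ->
  measurable_fun setT (fun t => (f t)^-1).
Proof.
move=> mf f0; have -> : (fun t => (f t)^-1) = (@powR R ^~ (-1)) \o f.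
  by apply/funext => t /=; rewrite powR_inv1.
by apply: measurableT_comp mf; exact: measurable_powR.
Qed.

Lemma measurable_flux c (F : 'rV[R]_d -> 'rV[R]_d) : measurable_fun setT F -> measurable_fun setT (flux c F).
Proof.
move=> mF; apply: measurable_funM.
  by apply: measurable_dotp => //; exact: measurable_subr_rV.
by apply: measurable_ge0_inv => [|x]; [exact: measurable_sqdist|exact: dotp_ge0].
Qed.

Lemma flux_bound c r (F : 'rV[R]_d -> 'rV[R]_d) (K : R) y : 0 < r -> (forall i, `|F y 0 i| <= K) ->
  esphere c r y -> `|flux c F y| <= d%:R * (K * r) / r ^+ 2.
Proof.
move=> r0 FK Sy; rewrite /flux (sqdist_esphere Sy) normrM.
rewrite [X in _ * X]ger0_norm ?invr_ge0 ?exprn_ge0 ?(ltW r0)//.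
rewrite ler_pM2r ?invr_gt0 ?exprn_gt0//; apply: ler_sum_cst => i.
rewrite normrM; apply: ler_pM => //.
by rewrite -Sy enormB; exact: coord_le_enorm.
Qed.

(** The right-hand side is the outward flux: integrals over the sphere are [d / r] times ball
    integrals of the radially projected function, and [flux] carries one more factor [1 / r]. *)
Lemma divergence_ball c r (Z : seq 'rV[R]_d) (F : 'rV[R]_d -> 'rV[R]_d)
    (D : 'I_d -> 'rV[R]_d -> R) (K : R) : 0 < r ->
  measurable_fun setT F -> (forall x i, `|F x 0 i| <= K) ->
  (forall x, enorm (c - x) <= r -> x \notin Z -> forall i,
     [/\ is_derive x (delta_mx 0 i) (fun y => F y 0 i) (D i x),
         {for x, continuous (fun y => F y 0 i)} & {for x, continuous (D i)}]) ->
  (forall x, esphere c r x -> x \notin Z) ->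
  (lebesgue_rV d).-integrable (eball c r) (EFin \o (fun x => \sum_(i < d) D i x)) ->
  (Z = [::] \/ 1 < d)%N ->
  \int[lebesgue_rV d]_(x in eball c r) (\sum_(i < d) D i x) =
  d%:R * \int[lebesgue_rV d]_(x in eball c r) flux c F (radial_proj c r x).
Proof.
move=> r0 mF FK FD SZ intD Zd; pose B := eball c r.
have mB : measurable B by exact: measurable_eball.
pose gamma x := flux c F (radial_proj c r x).
pose K' := `|d%:R * (K * r) / r ^+ 2|.
have gammaK x : `|gamma x| <= K'.
  have [->|xc] := eqVneq x c.
    by rewrite /gamma radial_proj_center /flux sqdistxx invr0 mulr0 normr0 /K'.
  apply: le_trans (flux_bound r0 _ (radial_proj_esphere r0 xc)) (ler_norm _).
  by move=> i; exact: FK.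
have mgamma : measurable_fun setT gamma.
  exact: (measurableT_comp (measurable_flux c mF) (measurable_radial_proj c r)).
have gammah (u : R) x : 0 < u -> gamma (c + u *: (x - c)) = gamma x.
  by move=> u0; rewrite /gamma radial_proj_dilate.
(* The cutoff is 1 while [sqdist c x] is at most n/(n+1) times [r ^ 2], and 0 from the sphere on,
   where its argument is exactly 1. *)
pose a n : R := n.+1%:R / r ^+ 2.
pose b n : R := - n%:R.
have a0 n : 0 < a n by rewrite divr_gt0// exprn_gt0.
have ab n : a n * r ^+ 2 + b n = 1.
  by rewrite /a /b divfK ?gt_eqF ?exprn_gt0// -natr1 addrAC subrr add0r.
pose phi n := radial_step c (a n) (b n).
pose dphi n := dradial_step c (a n) (b n).
have outB n x : ~ B x -> 1 <= a n * sqdist c x + b n.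
  move=> /negP; rewrite enorm_lt_sqdist// -leNgt => Bx.
  by rewrite -(ab n) lerD2r ler_pM2l.
have phi0 n x : ~ B x -> phi n x = 0 by move=> /outB h; exact: step_ge1.
have dphi0 n i x : ~ B x -> dphi n i x = 0.
  by move=> /(outB n) h; rewrite /dphi /dradial_step dstep_ge1// mul0r.
have phiK n x : `|phi n x| <= 1 by rewrite ger0_norm ?step_ge0// step_le1.
have mphi n : measurable_fun setT (phi n).
  by apply: continuous_measurable_rV; exact: continuous_radial_step.
have mdphi n i : measurable_fun setT (dphi n i).
  by apply: continuous_measurable_rV; exact: continuous_dradial_step.
have mFi i : measurable_fun setT (fun x => F x 0 i) by exact: measurable_coord_fun.
pose divF x := \sum_(i < d) D i x.
have sq0 x : 0 <= sqdist c x := dotp_ge0 _.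
(* This is minus the inner product of the gradient of [phi n] with [x - c]: nonnegative, and zero
   off the layer where [phi n] decreases. *)
pose w n x := - (2 * (a n * sqdist c x) * dstep (a n * sqdist c x + b n)).
have w_ge0 n x : 0 <= w n x.
  rewrite oppr_ge0; apply: mulr_ge0_le0; last exact: dstep_npos.
  by apply: mulr_ge0 => //; apply: mulr_ge0 => //; exact: ltW.
have sumdphi n x : \sum_(i < d) dphi n i x * F x 0 i = - (w n x * flux c F x).
  have -> : \sum_(i < d) dphi n i x * F x 0 i =
      dstep (a n * sqdist c x + b n) * (a n * (2 * dotp (F x) (x - c))).
    rewrite /dphi /dradial_step; move: (dstep _) => ds.
    by rewrite /dotp !mulr_sumr; apply: eq_bigr => i _; rewrite !mxE; ring.
  have [->|xc] := eqVneq x c.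
    have -> : dotp (F c) (c - c) = 0.
      by rewrite subrr -(scale0r (0 : 'rV[R]_d)) dotpZr mul0r.
    by rewrite /w sqdistxx; ring.
  rewrite /w /flux; field.
  by rewrite /sqdist -sqr_enorm sqrf_eq0 enorm_eq0 subr_eq0.
have coordB x i : B x -> `|x 0 i - c 0 i| <= r.
  move=> Bx; have := coord_le_enorm (c - x) i; rewrite !mxE distrC => /le_trans.
  by apply; exact: ltW.
have dphiK n i x : `|dphi n i x| <= 4 * (a n * (2 * r)).
  have [Bx|/dphi0 ->] := pselect (B x); last first.
    rewrite normr0; apply: mulr_ge0 => //; apply: mulr_ge0; first exact: ltW.
    by apply: mulr_ge0 => //; exact: ltW.
  rewrite normrM; apply: ler_pM => //; first exact: dstep_bound.
  rewrite normrM (gtr0_norm (a0 n)) ler_pM2l// normrM ger0_norm// ler_pM2l//.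
  exact: coordB.
have phi_1 x : B x -> phi n x @[n --> \oo] --> (1 : R).
  move=> Bx; apply: cvg_near_cst; near=> n; apply: step_le0.
  have q1 : sqdist c x / r ^+ 2 < 1.
    by rewrite ltr_pdivrMr ?exprn_gt0// mul1r -enorm_lt_sqdist.
  set q := sqdist c x / r ^+ 2 in q1 *.
  (* The right-hand side is nonpositive once [n >= q / (1 - q)], so the cutoff is eventually 1 at
     each point of the open ball. *)
  have -> : a n * sqdist c x + b n = q - n%:R * (1 - q).
    by rewrite /a /b -natr1 /q; field; rewrite gt_eqF.
  rewrite subr_le0 -ler_pdivrMr ?subr_gt0//.
  by near: n; exact: nbhs_infty_ger.
have lim_div : \int[lebesgue_rV d]_x (phi n x * divF x) @[n --> \oo] -->
    (\int[lebesgue_rV d]_(x in B) divF x : R).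
  have mdivF : measurable_fun B divF by apply/measurable_EFinP; case/integrableP : intD.
  have E n : \int[lebesgue_rV d]_x (phi n x * divF x) =
      \int[lebesgue_rV d]_(x in B) (phi n x * divF x).
    by apply: Rintegral_vanish => x Bx; rewrite phi0// mul0r.
  under eq_cvg do rewrite E.
  apply: (@Rintegral_dominated _ _ _ _ _ _ _ (fun x => `|divF x|)) => //.
  - by move=> n; apply: measurable_funM => //; exact: measurable_funTS.
  - apply: aeW => x Bx; rewrite -[X in _ --> X]mul1r.
    exact: (cvgM (phi_1 _ Bx) (cvg_cst (divF x))).
  - exact: (integrable_abse intD).
  - by move=> n x _; rewrite normrM ler_piMl.
have lim_gamma : \int[lebesgue_rV d]_x (w n x * gamma x) @[n --> \oo] -->
    (d%:R * \int[lebesgue_rV d]_(x in B) gamma x : R).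
  have E n : \int[lebesgue_rV d]_x (w n x * gamma x) =
      d%:R * \int[lebesgue_rV d]_(x in B) (phi n x * gamma x).
    rewrite -(@Rintegral_vanish _ _ _ _ B) => [|x Bx]; last by rewrite phi0// mul0r.
    by apply: (radial_mean r0 (a0 n) _ mgamma gammaK gammah); rewrite ab.
  under eq_cvg do rewrite E.
  apply: cvgM; first exact: cvg_cst.
  apply: (@Rintegral_dominated _ _ _ _ _ _ _ (cst K')) => //.
  - by move=> n; apply: measurable_funTS; exact: measurable_funM.
  - exact: measurable_funTS.
  - apply: aeW => x Bx; rewrite -[X in _ --> X]mul1r.
    exact: (cvgM (phi_1 _ Bx) (cvg_cst (gamma x))).
  - apply: (@bounded_integrable _ _ _ _ _ _ `|K'|) => //; exact: eball_lty.
  - by move=> n x _; rewrite normrM (le_trans _ (gammaK x))// ler_piMl.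
have mw n : measurable_fun setT (w n).
  have m1 : measurable_fun setT (fun x => a n * sqdist c x).
    by apply: measurable_funM => //; exact: measurable_sqdist.
  have mdstep : measurable_fun setT (@dstep R).
    by apply: continuous_measurable_fun; exact: continuous_dstep.
  apply: measurable_funN; apply: measurable_funM; first exact: measurable_funM.
  by apply: measurableT_comp => //; exact: measurable_funD.
have w0 n x : ~ B x -> w n x = 0.
  by move=> /(outB n) h; rewrite /w dstep_ge1// mulr0 oppr0.
have wK n x : `|w n x| <= 2 * (a n * r ^+ 2) * 4.
  have [Bx|/w0 ->] := pselect (B x); last first.
    rewrite normr0; apply: mulr_ge0 => //; apply: mulr_ge0 => //.
    by apply: mulr_ge0; [exact: ltW|rewrite exprn_ge0// ltW].
  rewrite normrN normrM; apply: ler_pM => //; last exact: dstep_bound.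
  rewrite normrM ger0_norm// ler_pM2l// normrM (gtr0_norm (a0 n)) ler_pM2l//.
  by rewrite ger0_norm ?dotp_ge0// ltW// -enorm_lt_sqdist.
have sub_cube x : ~ cube (enorm c + r) x -> ~ B x by apply: contra_not; exact: eball_sub_cube.
have intphi n : (lebesgue_rV d).-integrable setT (EFin \o (fun x => phi n x * divF x)).
  apply: (@integrable_vanish _ _ _ _ B) => // [x Bx|]; first by rewrite /= phi0// mul0r.
  by apply: (@bounded_mul_integrable _ _ _ _ _ _ _ 1) => //; exact: measurable_funTS.
have intwg n : (lebesgue_rV d).-integrable setT (EFin \o (fun x => w n x * gamma x)).
  apply: (@bounded_support_integrable _ _ _ (enorm c + r) (2 * (a n * r ^+ 2) * 4 * K')).
  - exact: measurable_funM.
  - by move=> x; rewrite normrM; apply: ler_pM.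
  - by move=> x /sub_cube Bx; rewrite w0// mul0r.
have intsum n : (lebesgue_rV d).-integrable setT
    (EFin \o (fun x => \sum_(i < d) dphi n i x * F x 0 i)).
  apply: (@bounded_support_integrable _ _ _ (enorm c + r)
    (d%:R * (4 * (a n * (2 * r)) * K))).
  - by apply: measurable_sum => i; exact: measurable_funM.
  - by move=> x; apply: ler_sum_cst => i; rewrite normrM; apply: ler_pM.
  - by move=> x /sub_cube Bx; rewrite big1// => i _; rewrite dphi0// mul0r.
have intwf n : (lebesgue_rV d).-integrable setT (EFin \o (fun x => w n x * flux c F x)).
  have -> : EFin \o (fun x => w n x * flux c F x) =
      (\- (EFin \o (fun x => \sum_(i < d) dphi n i x * F x 0 i)%R))%E.
    by apply/funext => x /=; rewrite sumdphi opprK.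
  exact: integrableN.
have div_flux n : \int[lebesgue_rV d]_x (phi n x * divF x) =
    \int[lebesgue_rV d]_x (w n x * flux c F x).
  apply/eqP; rewrite -subr_eq0 -RintegralB//.
  pose G i x := phi n x * F x 0 i.
  pose D' i x := phi n x * D i x + dphi n i x * F x 0 i.
  have D'E x : \sum_(i < d) D' i x = phi n x * divF x - w n x * flux c F x.
    by rewrite big_split/= sumdphi mulr_sumr.
  (* Beyond the closed ball no regularity of [F] is assumed; the field and its divergence vanish
     there thanks to the cutoff. *)
  have out x : r < enorm (c - x) -> \forall y \near x,
      phi n y = 0 /\ forall i, dphi n i y = 0.
    move=> xr; have /cvgr_gt : enorm (c - y) @[y --> x] --> enorm (c - x).
      apply: (@continuous_enorm _ _ (fun x => c - x)) => i.
      exact: continuous_subl_coord.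
    move=> /(_ _ xr); apply: filterS => y ry.
    have By : ~ B y by apply/negP; rewrite -leNgt ltW.
    by split => [|i]; rewrite ?phi0 ?dphi0.
  have M0 : 0 < enorm c + r by rewrite ltr_wpDl ?enorm_ge0.
  apply/eqP; transitivity (\int[lebesgue_rV d]_x (\sum_(i < d) D' i x)).
    by apply: eq_Rintegral => x _; rewrite D'E.
  apply: (@integral_div0 _ d Z G D' (enorm c + r) K) => //.
  - by move=> i; exact: measurable_funM.
  - move=> i x xZ; have [xr|xr] := leP (enorm (c - x)) r.
      have [h _ _] := FD x xr xZ i.
      have := is_deriveM (is_derive_radial_step c (a n) (b n) i x) h.
      suff -> : D' i x = phi n x *: D i x + F x 0 i *: dphi n i x by [].
      by rewrite /D' (mulrC (dphi _ _ _)).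
    have [p0 dp0] := nbhs_singleton (out x xr).
    rewrite /D' p0 dp0 !mul0r addr0; apply: is_derive_near0.
    by apply: filterS (out x xr) => y [y0 _]; rewrite /G y0 mul0r.
  - move=> i x xZ; have [xr|xr] := leP (enorm (c - x)) r.
      have [_ h _] := FD x xr xZ i.
      apply: (@continuousM _ _ (phi n) (fun x => F x 0 i)) => //.
      exact: continuous_radial_step.
    apply: continuous_near0.
    by apply: filterS (out x xr) => y [y0 _]; rewrite /G y0 mul0r.
  - move=> i x xZ; have [xr|xr] := leP (enorm (c - x)) r.
      have [_ h h'] := FD x xr xZ i.
      apply: (@continuousD _ _ _ (fun x => phi n x * D i x) (fun x => dphi n i x * F x 0 i)).
        by apply: (@continuousM _ _ (phi n) (D i)) => //; exact: continuous_radial_step.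
      apply: (@continuousM _ _ (dphi n i) (fun x => F x 0 i)) => //.
      exact: continuous_dradial_step.
    apply: continuous_near0.
    by apply: filterS (out x xr) => y [y0 dy0]; rewrite /D' y0 dy0 !mul0r addr0.
  - move=> i x; rewrite normrM -[K]mul1r; apply: ler_pM => //.
  - by move=> i x /sub_cube Bx; rewrite /G /D' phi0// dphi0// !mul0r addr0.
  - under eq_fun do rewrite D'E.
    exact: (integrableB _ (intphi n) (intwf n)).
have lim_diff : \int[lebesgue_rV d]_x (w n x * flux c F x) -
    \int[lebesgue_rV d]_x (w n x * gamma x) @[n --> \oo] --> (0 : R).
  have cflux y : esphere c r y -> {for y, continuous (flux c F)}.
    move=> Sy; have yr : enorm (c - y) <= r by rewrite Sy.
    have cFy i : {for y, continuous (fun x => F x 0 i)}.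
      by have [] := FD y yr (SZ y Sy) i.
    apply: (@continuousM _ _ (fun y => dotp (F y) (y - c)) (fun y => (sqdist c y)^-1)).
      apply: (@continuous_dotp _ _ F (fun y => y - c)) => // i.
      exact: continuous_subr_coord.
    apply: (@continuousV _ _ (sqdist c)); last exact: continuous_sqdist.
    by rewrite (sqdist_esphere Sy) gt_eqF// exprn_gt0.
  pose V := fine (lebesgue_rV d B).
  have V0 : 0 <= V by rewrite fine_ge0.
  apply/cvgrPdist_le => e e0.
  (* [d * V] will bound the mass of [w n]; the added 1 keeps the divisor positive. *)
  have dV : 0 < d%:R * V + 1 by rewrite ltr_wpDl// mulr_ge0.
  have e'0 : 0 < e / (d%:R * V + 1) by rewrite divr_gt0.
  have := sphere_layer e'0 cflux; set e' := e / _ => layer.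
  apply: filterS layer => n layer.
  rewrite sub0r normrN -RintegralB//.
  have intw : (lebesgue_rV d).-integrable setT (EFin \o w n).
    apply: (@bounded_support_integrable _ _ _ (enorm c + r) _ (mw n) (wK n)).
    by move=> x /sub_cube Bx; rewrite w0.
  have intd := integrableB measurableT (intwf n) (intwg n).
  apply: (le_trans (le_normr_Rintegral measurableT intd)).
  apply: (@le_trans _ _ (\int[lebesgue_rV d]_x (e' * w n x))).
    apply: le_Rintegral => //.
    - exact: (integrable_abse intd).
    - have -> : EFin \o (fun x => e' * w n x) = (fun x => e'%:E * (EFin \o w n) x)%E.
        by apply/funext => x /=; rewrite EFinM.
      exact: integrableZl.
    move=> x _; rewrite -mulrBr normrM ger0_norm// mulrC.
    have [Bx|/w0 ->] := pselect (B x); last by rewrite !mulr0.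
    have [s0|s0] := leP (a n * sqdist c x + b n) 0.
      by rewrite /w dstep_le0// mulr0 oppr0 !mulr0.
    rewrite ler_wpM2r//.
    have xc : x != c.
      apply/eqP => xc; move: s0; rewrite xc sqdistxx mulr0 add0r /b.
      by rewrite ltNge oppr_le0 ler0n.
    have {1}-> := radial_projK c x r0.
    apply: layer; first exact: radial_proj_esphere.
    set tau := enorm (x - c) / r.
    have tau2 : tau ^+ 2 * n.+1%:R = a n * sqdist c x.
      by rewrite /tau /a exprMn exprVn sqr_enorm /sqdist; field; rewrite gt_eqF.
    have tau0 : 0 <= tau by rewrite divr_ge0 ?enorm_ge0// ltW.
    have tau1 : tau <= 1.
      by rewrite ler_pdivrMr// mul1r enormB ltW.
    rewrite distrC ger0_norm ?subr_ge0//.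
    (* The argument of [dstep] is positive here, which says that n+1 times [tau ^ 2] exceeds n;
       hence [1 - tau <= 1 - tau ^ 2 <= 1/(n+1)]. *)
    apply: (@le_trans _ _ (1 - tau ^+ 2)); first by rewrite lerD2l lerN2 expr2 ler_piMl.
    rewrite -[leRHS]mul1r ler_pdivlMr// mulrBl mul1r tau2.
    by move: s0; rewrite /b -natr1; set X : R := a n * _; set m : R := n%:R; lra.
  rewrite RintegralZl//.
  (* The mass of the weight, by the dilation identity with [gamma] constant equal to 1. *)
  have -> : \int[lebesgue_rV d]_x w n x = d%:R * \int[lebesgue_rV d]_(x in B) phi n x.
    have := @radial_mean _ d c (a n) (b n) r (cst 1) 1 r0 (a0 n).
    rewrite ab => /(_ (lexx _)) h.
    rewrite -(@Rintegral_vanish _ _ _ _ B) => [|x Bx]; last by rewrite phi0.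
    have := h _ _ _; under eq_Rintegral do rewrite /= mulr1.
    move=> -> //; last by move=> x; rewrite normr1.
    by under eq_Rintegral do rewrite /= mulr1.
  have phiV : \int[lebesgue_rV d]_(x in B) phi n x <= V.
    have := @le_Rintegral_cst _ _ _ (lebesgue_rV d) B (phi n) 1 mB (eball_lty c r)
      (measurable_funTS (mphi n)) (fun x _ => phiK n x).
    by rewrite mul1r; apply: le_trans; exact: ler_norm.
  apply: (@le_trans _ _ (e' * (d%:R * V))).
    by apply: ler_wpM2l; [exact: ltW|exact: ler_wpM2l].
  rewrite /e' mulrAC ler_pdivrMr//; apply: ler_wpM2l; first exact: ltW.
  by rewrite lerDl.
have lim2 : \int[lebesgue_rV d]_x (phi n x * divF x) @[n --> \oo] -->
    (d%:R * \int[lebesgue_rV d]_(x in B) gamma x : R).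
  have E n : \int[lebesgue_rV d]_x (phi n x * divF x) =
      (\int[lebesgue_rV d]_x (w n x * flux c F x) -
       \int[lebesgue_rV d]_x (w n x * gamma x)) +
      \int[lebesgue_rV d]_x (w n x * gamma x) by rewrite subrK div_flux.
  under eq_cvg do rewrite E.
  have h := cvgD lim_diff lim_gamma; rewrite add0r in h.
  exact: (h _).
exact: (cvg_unique _ lim_div lim2).
Unshelve. all: by end_near. Qed.

End divergence_ball.

(** * The uniform law on a sphere *)

Section sphere_integral.
Context {R : realType} {d : nat}.
Implicit Types (c x y : 'rV[R]_d) (r : R).

Lemma integral_mrestr_sub dT (T : measurableType dT)
    (mu : {measure set T -> \bar R}) (D E : set T) (mD : measurable D) (f : T -> R) :
  E `<=` D -> \int[mrestr mu mD]_(x in E) f x = \int[mu]_(x in E) f x.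
Proof.
move=> ED; rewrite /Rintegral; congr fine; apply: eq_measure_integral => A mA AE.
by rewrite /= /mrestr setIidl//; exact: subset_trans ED.
Qed.

Lemma measurable_esphere c r : measurable (esphere c r).
Proof.
have -> : esphere c r = setT `&` (fun x => enorm (c - x)) @^-1` [set r].
  by rewrite setTI.
by apply: measurable_enorm_sub => //; exact: measurable_set1.
Qed.

Lemma preimage_radial_proj_esphere c r : 0 < r ->
  radial_proj c r @^-1` esphere c r = ~` [set c].
Proof.
move=> r0; apply/seteqP; split => x /=.
  move=> + xc; rewrite xc radial_proj_center /esphere/= subrr.
  have /eqP := enorm_eq0 (0 : 'rV[R]_d); rewrite eqxx => /eqP/eqP ->.
  by move=> r0'; move: r0; rewrite -r0' ltxx.
by move=> /eqP xc; exact: radial_proj_esphere.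
Qed.

Lemma radial_proj_bound c r (g : 'rV[R]_d -> R) (K : R) : 0 < r ->
  (forall x, esphere c r x -> `|g x| <= K) ->
  forall x, `|g (radial_proj c r x)| <= Num.max K `|g c|.
Proof.
move=> r0 gK x; have [->|xc] := eqVneq x c.
  by rewrite radial_proj_center le_max lexx orbT.
by rewrite le_max gK//; exact: radial_proj_esphere.
Qed.

(** [sphere_measure] is [d / r] times the image under [radial_proj] of the volume of the ball. The
    centre, which misses the sphere, is null as [0 < d]. *)
Lemma integral_sphere c r (g : 'rV[R]_d -> R) (K : R) : (0 < d)%N -> 0 < r ->
  measurable_fun setT g -> (forall x, esphere c r x -> `|g x| <= K) ->
  \int[sphere_measure c r]_(x in esphere c r) g x =
  d%:R / r * \int[lebesgue_rV d]_(x in eball c r) g (radial_proj c r x).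
Proof.
move=> d0 r0 mg gK; pose B := eball c r; pose S := esphere c r.
have mB : measurable B by exact: measurable_eball.
have mS : measurable S by exact: measurable_esphere.
have mproj := @measurable_radial_proj R d c r.
pose nu := mrestr (lebesgue_rV d) mB.
have nuT : (nu setT < +oo)%E by rewrite /nu /mrestr setTI; exact: eball_lty.
have nuB : nu (~` B) = 0%E by rewrite /nu /mrestr setICl measure0.
have preS := @preimage_radial_proj_esphere c r r0.
have mpreS : measurable (radial_proj c r @^-1` S).
  by rewrite preS; apply: measurableC; exact: measurable_set1_rV.
have intproj (D : set 'rV[R]_d) : measurable D ->
    (nu : {measure set _ -> \bar R}).-integrable D (EFin \o (g \o radial_proj c r)).
  move=> mD; apply: (@bounded_integrable _ _ _ _ _ _ (Num.max K `|g c|)) => //.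
  - by apply: le_lt_trans nuT; apply: le_measure; rewrite ?inE.
  - exact: measurable_funTS (measurableT_comp mg mproj).
  - by move=> x _; exact: radial_proj_bound.
have intS : (pushm nu mproj).-integrable S (EFin \o g).
  apply: integrable_pushforward => //; first exact/measurable_EFinP.
  exact: intproj.
transitivity (\int[mscale (d%:R / `|r|)%:nng (pushm nu mproj)]_(x in S) g x).
  rewrite /Rintegral; congr fine; apply: eq_measure_integral => A mA AS.
  rewrite -[LHS]/((d%:R / `|r|)%:E * lebesgue_rV d (B `&` radial_proj c r @^-1` A))%E.
  by rewrite setIC.
rewrite Rintegral_mscale//= gtr0_norm//; congr (_ * _).
transitivity (\int[nu]_(x in radial_proj c r @^-1` S) (g (radial_proj c r x))).
  rewrite /Rintegral; congr fine; rewrite integral_pushforward//.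
    exact/measurable_EFinP.
  exact: intproj.
transitivity (\int[nu]_(x in (radial_proj c r @^-1` S) `\` ~` B) g (radial_proj c r x)).
  rewrite /Rintegral; congr fine; apply: negligible_integral => //.
  - exact: measurableC.
  - exact: intproj.
rewrite integral_mrestr_sub; last by move=> x [_] /contrapT.
have -> : radial_proj c r @^-1` S `\` ~` B = B `\` [set c].
  by rewrite preS; apply/seteqP; split => x [h1 h2]; split => //; exact: contrapT.
rewrite /Rintegral; congr fine; apply/esym/negligible_integral => //.
- exact: measurable_set1_rV.
- apply: (@bounded_integrable _ _ _ _ _ _ (Num.max K `|g c|)) => //.
  + exact: eball_lty.
  + exact: measurable_funTS (measurableT_comp mg mproj).
  + by move=> x _; exact: radial_proj_bound.
- exact: lebesgue_rV_set1.
Qed.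

Lemma sphere_measure_esphere c r : (0 < d)%N -> 0 < r ->
  fine (sphere_measure c r (esphere c r)) = d%:R / r * fine (lebesgue_rV d (eball c r)).
Proof.
move=> d0 r0.
have := @integral_sphere c r (cst 1) 1 d0 r0 (measurable_cst _).
have mS := measurable_esphere c r; have mB := measurable_eball c r.
rewrite !Rintegral_cst// !mul1r; apply => x _.
by rewrite normr1.
Qed.

End sphere_integral.

Section uniform_sphere_expectation.
Context {R : realType} {d : nat} {dO : measure_display}.
Context {Omega : measurableType dO} (Q : probability Omega R).
Implicit Types (c x y : 'rV[R]_d) (r : R).

(** The law of [X] is the normalized surface measure, and the factor [d / r] cancels between
    integral and total area, leaving an average over the ball. *)
Lemma expectation_uniform_sphere (X : {RV Q >-> 'rV[R]_d}) c r
    (g : 'rV[R]_d -> R) (K : R) : (0 < d)%N -> 0 < r ->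
  uniform_on_sphere c r X -> measurable_fun setT g ->
  (forall x, esphere c r x -> `|g x| <= K) ->
  ('E_Q[(fun w => g (X w) : R)] = ((fine (lebesgue_rV d (eball c r)))^-1 *
    \int[lebesgue_rV d]_(x in eball c r) g (radial_proj c r x))%:E)%E.
Proof.
move=> d0 r0 unifX mg gK; pose S := esphere c r.
have mS : measurable S by exact: measurable_esphere.
have mX : measurable_fun setT X by [].
pose sigma := sphere_measure c r.
have V0 : 0 < fine (lebesgue_rV d (eball c r)).
  by rewrite fine_gt0// eball_gt0// eball_lty.
have sS : fine (sigma S) = d%:R / r * fine (lebesgue_rV d (eball c r)).
  exact: sphere_measure_esphere.
have sS0 : 0 < fine (sigma S) by rewrite sS mulr_gt0// divr_gt0// ltr0n.
have sSoo : (sigma S < +oo)%E.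
  by rewrite ltNge; apply/negP; rewrite leye_eq => /eqP sSoo; move: sS0; rewrite sSoo ltxx.
have QT : (Q setT < +oo)%E by rewrite probability_setT ltry.
(* [g] is bounded on the sphere only, where [X] lies almost surely; the truncation is bounded
   everywhere and integrable for the measures below. *)
pose g' x := g x * \1_S x.
have mg' : measurable_fun setT g' by apply: measurable_funM => //; exact: measurable_indic.
have g'S x : S x -> g' x = g x by move=> Sx; rewrite /g' indicE mem_set// mulr1.
have g'0 x : ~ S x -> g' x = 0 by move=> Sx; rewrite /g' indicE memNset// mulr0.
have g'K x : `|g' x| <= `|K|.
  have [Sx|Sx] := pselect (S x); last by rewrite g'0// normr0.
  by rewrite g'S// (le_trans (gK _ Sx))// ler_norm.
have ki : 0 <= (fine (sigma S))^-1 by rewrite invr_ge0 ltW.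
pose nu := mscale (NngNum ki) (mrestr sigma mS).
have QE A : measurable A -> pushm Q mX A = nu A.
  move=> mA; rewrite -[LHS]/(Q (X @^-1` A)) unifX// mulrC EFinM.
  congr (_ * _)%E; rewrite fineK// ge0_fin_numE//.
  apply: le_lt_trans sSoo; apply: le_measure; rewrite ?inE//.
  exact: measurableI.
have -> : ('E_Q[(fun w => g (X w) : R)] = \int[Q]_w (g' (X w))%:E)%E.
  rewrite unlock; apply: ae_eq_integral => //.
  - by apply/measurable_EFinP; exact: measurableT_comp mg mX.
  - by apply/measurable_EFinP; exact: measurableT_comp mg' mX.
  - exists (X @^-1` (~` S)); split.
    + by have := mX measurableT _ (measurableC mS); rewrite setTI.
    + rewrite -[LHS]/(pushm Q mX (~` S)) QE; last exact: measurableC.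
      rewrite -[LHS]/((fine (sigma S))^-1%:E * sigma (~` S `&` S))%E.
      by rewrite setICl /sigma measure0 mule0.
    + move=> w /= h Sw; apply: h => _; rewrite g'S//.
have intg' : (sigma : {measure set _ -> \bar R}).-integrable S (EFin \o g').
  apply: (@bounded_integrable _ _ _ _ _ _ `|K|) => //; exact: measurable_funTS.
have -> : (\int[Q]_w (g' (X w))%:E = \int[pushm Q mX]_x (g' x)%:E)%E.
  rewrite integral_pushforward//; first exact/measurable_EFinP.
  rewrite preimage_setT; apply: (@bounded_integrable _ _ _ _ _ _ `|K|) => //.
  exact: measurableT_comp mg' mX.
have -> : (\int[pushm Q mX]_x (g' x)%:E = \int[nu]_x (g' x)%:E)%E.
  by apply: eq_measure_integral => A mA _; exact: QE.
have intr : (mrestr sigma mS : {measure set _ -> \bar R}).-integrable setT (EFin \o g').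
  apply: (@bounded_integrable _ _ _ _ _ _ `|K|) => //.
  by rewrite -[X in (X < _)%E]/(sigma (setT `&` S)) setTI.
have intrS := integrableS measurableT mS (@subsetT _ S) intr.
rewrite integral_mscale// (@integral_vanish _ _ _ _ S) => [|x /g'0 /= ->//].
rewrite -(EFin_Rintegral mS intrS) -EFinM; congr (_%:E).
rewrite integral_mrestr_sub// (eq_Rintegral _ (g := g)) => [|x]; last first.
  by rewrite inE => /g'S.
rewrite (integral_sphere d0 r0 mg gK) /= sS.
by field; rewrite !gt_eqF ?ltr0n.
Qed.

End uniform_sphere_expectation.

(** * The score and its direction *)

Section score.
Context {R : realType} {d : nat}.
Variable p : 'rV[R]_d -> R.
Hypotheses (p_ge0 : forall x, 0 <= p x) (p_smooth : smooth p).
Implicit Types x y : 'rV[R]_d.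

Lemma smooth_continuous : continuous p.
Proof. by have [] := p_smooth [::]. Qed.

Lemma smooth_continuous_partial i : continuous (partial i p).
Proof. by have [] := p_smooth [:: i]. Qed.

Lemma smooth_continuous_partial2 i j : continuous (partial j (partial i p)).
Proof. by have [] := p_smooth [:: j; i]. Qed.

Lemma smooth_is_derive i x : is_derive x (delta_mx 0 i) p (partial i p x).
Proof. by apply: derivableP; have [_ h] := p_smooth [::]; exact: h. Qed.

Lemma smooth_is_derive_partial i j x :
  is_derive x (delta_mx 0 j) (partial i p) (partial j (partial i p) x).
Proof. by apply: derivableP; have [_ h] := p_smooth [:: i]; exact: h. Qed.

Lemma smooth_is_derive_line i x (h : R) :
  is_derive h (1 : R) (fun h : R => p (h *: delta_mx 0 i + x))
    (partial i p (h *: delta_mx 0 i + x)).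
Proof.
apply: is_derive_line (smooth_is_derive i (h *: delta_mx 0 i + x)) => k.
by rewrite addrA -scalerDl [k *: 1]mulr1.
Qed.

(** A zero of a nonnegative function is a minimum along every coordinate line. *)
Lemma gradient_zero x : p x = 0 -> gradient p x = 0.
Proof.
move=> px; apply/rowP => i; rewrite !mxE.
pose g (h : R) := p (h *: delta_mx 0 i + x).
have gd := smooth_is_derive_line i x.
have [||||_ g0] := @derive1_at_min R g (-1) 1 0.
- exact: le_trans (lerN10 R) ler01.
- by move=> t _; have [] := gd t.
- by rewrite in_itv/= ltrN10 ltr01.
- by move=> t _; rewrite /g scale0r add0r px.
by have [_] := gd 0; rewrite g0 scale0r add0r.
Qed.

(** Since [ln 0 = 0], the difference quotient is [h^-1 * ln (p y)] with [y] near [x]. If [p y] is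
    positive and small, this exceeds [1 / |h|] in absolute value; so a convergent quotient forces
    [p y = 0] for all small [h], and the limit is 0. A divergent one gets the default value 0. *)
Lemma score_zero x : p x = 0 -> score p x = 0.
Proof.
move=> px; apply/rowP => i; rewrite !mxE /partial /derive.
set q := (X in X @ _); have [cq|dq] := pselect (cvg (q @ 0^')); last by rewrite dvgP.
apply: cvg_lim => //.
have {cq}qL : q @ 0^' --> lim (q @ 0^') by [].
set L := lim (q @ 0^') in qL.
apply: cvg_near_cst.
have h1 : \forall h \near 0^', `|L - q h| < 1 by move/cvgrPdist_lt : qL; exact.
(* Below [expR (-1)] the logarithm of a positive number is less than -1. *)
have h2 : \forall h \near (0 : R)^', p (h *: delta_mx 0 i + x) < expR (-1).
  have ch : {for 0, continuous (fun h : R => p (h *: delta_mx 0 i + x))}.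
    apply: differentiable_continuous; apply/derivable1_diffP.
    by have [] := smooth_is_derive_line i x 0.
  have H : \forall h \near (0 : R), p (h *: delta_mx 0 i + x) < expR (-1).
    by move/cvgr_lt : ch; apply; rewrite scale0r add0r px expR_gt0.
  by rewrite near_withinE; apply: filterS H => h ph _.
have h3 : \forall h \near (0 : R)^', `|h| < (`|L| + 1)^-1.
  by apply: dnbhs0_lt; rewrite invr_gt0 ltr_wpDl.
near=> h.
have qh : `|L - q h| < 1 by near: h.
have ph : p (h *: delta_mx 0 i + x) < expR (-1) by near: h.
have hL : `|h| < (`|L| + 1)^-1 by near: h.
have h0 : 0 < `|h| by rewrite normr_gt0; near: h; exact: nbhs_dnbhs_neq.
have qE : q h = h^-1 * ln (p (h *: delta_mx 0 i + x)).
  by rewrite /q /= px (ln0 (lexx 0)) subr0.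
have [p0|p0] := eqVneq (p (h *: delta_mx 0 i + x)) 0.
  by rewrite qE p0 ln0// mulr0.
have lnp : ln (p (h *: delta_mx 0 i + x)) < -1.
  by rewrite -ltr_expR lnK// posrE lt_def p0 p_ge0.
have q1 : `|q h| < `|L| + 1.
  have := ler_normB L (L - q h); rewrite subKr => /le_lt_trans; apply.
  by rewrite ltrD2l.
have : `|L| + 1 < `|q h|.
  rewrite qE normrM normfV.
  have l1 : 1 < `|ln (p (h *: delta_mx 0 i + x))|.
    by rewrite ltr0_norm 1?ltrNr// (lt_trans lnp)// ltrN10.
  apply: (@lt_trans _ _ `|h|^-1).
    by rewrite -[ltLHS]invrK ltf_pV2// posrE// invr_gt0 ltr_wpDl.
  by rewrite ltr_pMr ?invr_gt0.
by move=> /(lt_trans q1); rewrite ltxx.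
Unshelve. all: by end_near. Qed.

Lemma scoreE x : score p x = (p x)^-1 *: gradient p x.
Proof.
have [px|px] := eqVneq (p x) 0.
  by rewrite (score_zero px) (gradient_zero px) scaler0.
have px0 : 0 < p x by rewrite lt_def px p_ge0.
apply/rowP => i; rewrite !mxE /partial.
have h := is_derive_comp (smooth_is_derive i x) (is_derive1_ln px0).
have [_ <-] := h; by [].
Qed.

Lemma score_eq0 x : score p x = 0 <-> gradient p x = 0.
Proof.
rewrite scoreE; split=> [/eqP|->]; last by rewrite scaler0.
rewrite scaler_eq0 invr_eq0 => /orP[/eqP/gradient_zero//|/eqP//].
Qed.

Lemma score_neq0_gt0 x : score p x <> 0 -> 0 < p x.
Proof.
move=> sx; rewrite lt_def p_ge0 andbT; apply/eqP => /score_zero; exact: sx.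
Qed.

Lemma normalize_score x : normalize (score p x) = normalize (gradient p x).
Proof.
have [px|px] := eqVneq (p x) 0.
  by rewrite (score_zero px) (gradient_zero px).
by rewrite scoreE normalizeZ// invr_gt0 lt_def px p_ge0.
Qed.

End score.

(** * Regularity of the direction field off the critical points *)

Section direction_field.
Context {R : realType} {d : nat}.
Variable p : 'rV[R]_d -> R.
Hypothesis p_smooth : smooth p.
Implicit Types x y : 'rV[R]_d.

Let N2 x := dotp (gradient p x) (gradient p x).

Lemma continuous_gradient i : continuous (fun x => gradient p x 0 i).
Proof.
have -> : (fun x => gradient p x 0 i) = partial i p by apply/funext => x; rewrite mxE.
exact: smooth_continuous_partial.
Qed.

Let dN2 i x := \sum_(k < d) (2 * (partial k p x * partial i (partial k p) x)).

Let is_derive_N2 i x : is_derive x (delta_mx 0 i) N2 (dN2 i x).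
Proof.
have -> : N2 = \sum_(k < d) (partial k p * partial k p).
  apply/funext => y; rewrite fct_sumE /N2 /dotp.
  by apply: eq_bigr => k _; rewrite !mxE.
apply: is_derive_sum => k; have h := smooth_is_derive_partial p_smooth k i x.
have := is_deriveM h h.
suff -> : 2 * (partial k p x * partial i (partial k p) x) =
  partial k p x *: partial i (partial k p) x +
  partial k p x *: partial i (partial k p) x by [].
by rewrite -mulr2n mulr_natl.
Qed.

Let continuous_N2 : continuous N2.
Proof.
by move=> x; apply: continuous_dotp => i; exact: continuous_gradient.
Qed.

Let continuous_dN2 i : continuous (dN2 i).
Proof.
move=> x; apply: continuous_sum_rV => k.
apply: (@continuousM _ _ (cst 2) (fun x => partial k p x * partial i (partial k p) x)).
  exact: cst_continuous.
apply: continuousM; first exact: smooth_continuous_partial.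
exact: smooth_continuous_partial2.
Qed.

(** The derivative of [t ^ (-1/2)], in the shape given by the rule for inverses. *)
Let dinvsqrt (t : R) : R := - (Num.sqrt t) ^- 2 * (2 * Num.sqrt t)^-1.

Let is_derive_invsqrt (t : R) : 0 < t ->
  is_derive t (1 : R) (fun t => (Num.sqrt t)^-1) (dinvsqrt t).
Proof.
move=> t0; apply: is_deriveV; first by rewrite gt_eqF// sqrtr_gt0.
exact: is_derive1_sqrt.
Qed.

Let N2_gt0 x : gradient p x <> 0 -> 0 < N2 x.
Proof. by move=> /eqP; rewrite -enorm_gt0 /N2 -sqr_enorm => gx; rewrite exprn_gt0. Qed.

Let dF i x := (Num.sqrt (N2 x))^-1 * partial i (partial i p) x +
  partial i p x * (dinvsqrt (N2 x) * dN2 i x).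

Let F x := normalize (gradient p x).

Let FE i : (fun x => F x 0 i) = (fun x => (Num.sqrt (N2 x))^-1 * partial i p x).
Proof. by apply/funext => x; rewrite /F /normalize !mxE. Qed.

Let is_derive_F i x : gradient p x <> 0 ->
  is_derive x (delta_mx 0 i) (fun x => F x 0 i) (dF i x).
Proof.
move=> /N2_gt0 gx; rewrite FE.
have h1 := is_derive_comp (is_derive_N2 i x) (is_derive_invsqrt gx).
exact: (is_deriveM h1 (smooth_is_derive_partial p_smooth i i x)).
Qed.

Let continuous_sqrtN2 x : {for x, continuous (fun x => Num.sqrt (N2 x))}.
Proof.
apply: (@continuous_comp _ _ _ N2 Num.sqrt); first exact: continuous_N2.
exact: sqrt_continuous.
Qed.

Let continuous_invsqrtN2 x : gradient p x <> 0 ->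
  {for x, continuous (fun x => (Num.sqrt (N2 x))^-1)}.
Proof.
move=> /N2_gt0 gx; apply: (@continuousV _ _ (fun x => Num.sqrt (N2 x))).
  by rewrite gt_eqF// sqrtr_gt0.
exact: continuous_sqrtN2.
Qed.

Let continuous_dF i x : gradient p x <> 0 -> {for x, continuous (dF i)}.
Proof.
move=> gx; have g0 := N2_gt0 gx.
apply: (@continuousD _ _ _ (fun x => (Num.sqrt (N2 x))^-1 * partial i (partial i p) x)
  (fun x => partial i p x * (dinvsqrt (N2 x) * dN2 i x))).
  apply: (@continuousM _ _ (fun x => (Num.sqrt (N2 x))^-1) (partial i (partial i p))).
    exact: continuous_invsqrtN2.
  exact: smooth_continuous_partial2.
apply: (@continuousM _ _ (partial i p) (fun x => dinvsqrt (N2 x) * dN2 i x)).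
  exact: smooth_continuous_partial.
apply: (@continuousM _ _ (fun x => dinvsqrt (N2 x)) (dN2 i)); last exact: continuous_dN2.
apply: (@continuousM _ _ (fun x => - (Num.sqrt (N2 x)) ^- 2)
  (fun x => (2 * Num.sqrt (N2 x))^-1)).
  apply: (@continuousN _ _ _ (fun x => (Num.sqrt (N2 x)) ^- 2)).
  apply: (@continuousV _ _ (fun x => (Num.sqrt (N2 x)) ^+ 2)).
    by rewrite gt_eqF// exprn_gt0// sqrtr_gt0.
  apply: (@continuousM _ _ (fun x => Num.sqrt (N2 x)) (fun x => Num.sqrt (N2 x)));
  exact: continuous_sqrtN2.
apply: (@continuousV _ _ (fun x => 2 * Num.sqrt (N2 x))).
  by rewrite gt_eqF// mulr_gt0// sqrtr_gt0.
apply: (@continuousM _ _ (cst 2) (fun x => Num.sqrt (N2 x))); first exact: cst_continuous.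
exact: continuous_sqrtN2.
Qed.

(** Critical points are no obstacle: each coordinate is a continuous function times the inverse of a
    nonnegative continuous one, and such an inverse is measurable, with value 0 at the zeros. *)
Lemma measurable_normalize_gradient : measurable_fun setT (fun x => normalize (gradient p x)).
Proof.
apply: measurable_fun_rV => i; under eq_fun do rewrite !mxE.
apply: measurable_funM; last first.
  by apply: continuous_measurable_rV; exact: smooth_continuous_partial.
apply: measurable_ge0_inv => [|x]; last exact: enorm_ge0.
apply: continuous_measurable_rV => x.
by apply: continuous_enorm => k; exact: continuous_gradient.
Qed.

Lemma normalize_gradient_bound x i : `|normalize (gradient p x) 0 i| <= 1.
Proof.
rewrite (le_trans (coord_le_enorm _ _))//.
have [->|gx] := eqVneq (gradient p x) 0; last by rewrite enorm_normalize.
by rewrite normalize0 (eqP (_ : enorm 0 == 0)) ?enorm_eq0.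
Qed.

Lemma normalize_gradient_C1 i x : gradient p x <> 0 ->
  [/\ is_derive x (delta_mx 0 i) (fun y => normalize (gradient p y) 0 i)
        (partial i (fun y => normalize (gradient p y) 0 i) x),
      {for x, continuous (fun y => normalize (gradient p y) 0 i)} &
      {for x, continuous (partial i (fun y => normalize (gradient p y) 0 i))}].
Proof.
move=> gx; split.
- by apply: derivableP; have [] := is_derive_F i gx.
- rewrite -/F FE; apply: (@continuousM _ _ (fun x => (Num.sqrt (N2 x))^-1) (partial i p)).
    exact: continuous_invsqrtN2.
  exact: smooth_continuous_partial.
(* Being noncritical is an open condition, so the formula [dF] holds around [x] and transfers its
   continuity to the partial derivative. *)
- have near_neq0 : \forall y \near x, gradient p y <> 0.
    have /cvgr_gt : N2 y @[y --> x] --> N2 x by exact: continuous_N2.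
    move=> /(_ _ (N2_gt0 gx)); apply: filterS => y Ny gy.
    by move: Ny; rewrite /N2 -sqr_enorm gy (eqP (_ : enorm 0 == 0)) ?enorm_eq0// expr0n ltxx.
  have E : \forall y \near x, dF i y = partial i (fun y => F y 0 i) y.
    by apply: filterS near_neq0 => y gy; have [_ <-] := is_derive_F i gy.
  have : dF i y @[y --> x] --> partial i (fun y => F y 0 i) x.
    by rewrite -(nbhs_singleton E); exact: continuous_dF.
  by move=> h; apply: cvg_trans h; exact: near_eq_cvg E.
Qed.

End direction_field.

(** * Transport of spherical means by homotheties *)

Section affine_sphere.
Context {R : realType} {d : nat}.
Implicit Types (c x y : 'rV[R]_d) (r : R).

Lemma eball_affine c (k r : R) y : 0 < k ->
  eball c (k * r) (c + k *: y) <-> eball 0 r y.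
Proof.
move=> k0; rewrite /eball/= opprD addrA subrr !sub0r !enormN enormZ gtr0_norm//.
by rewrite ltr_pM2l.
Qed.

Lemma radial_proj_affine c (k r : R) y : 0 < k ->
  radial_proj c (k * r) (c + k *: y) = c + k *: radial_proj 0 r y.
Proof.
by move=> k0; rewrite /radial_proj addrAC subrr add0r subr0 add0r normalizeZ// scalerA.
Qed.

Lemma mean_eball_affine c (k r : R) (h : 'rV[R]_d -> R) (K : R) : 0 < k -> 0 < r ->
  measurable_fun setT h -> (forall x, `|h x| <= K) ->
  (fine (lebesgue_rV d (eball 0 r)))^-1 *
    \int[lebesgue_rV d]_(y in eball 0 r) h (c + k *: y) =
  (fine (lebesgue_rV d (eball c (k * r))))^-1 *
    \int[lebesgue_rV d]_(x in eball c (k * r)) h x.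
Proof.
move=> k0 r0 mh hK; pose B := eball c (k * r).
have mB : measurable B by exact: measurable_eball.
pose f x := h x * \1_B x.
have mf : measurable_fun setT f by apply: measurable_funM => //; exact: measurable_indic.
have f0 x : ~ B x -> f x = 0 by move=> Bx; rewrite /f indicE memNset// mulr0.
have fh x : B x -> f x = h x by move=> Bx; rewrite /f indicE mem_set// mulr1.
have fK x : `|f x| <= `|K|.
  have [Bx|Bx] := pselect (B x); last by rewrite f0// normr0.
  by rewrite fh// (le_trans (hK _))// ler_norm.
have f0' y : ~ eball 0 r y -> f (c + k *: y) = 0.
  by move=> ry; apply: f0 => /(eball_affine c r y k0).
have -> : \int[lebesgue_rV d]_(x in B) h x = \int[lebesgue_rV d]_x f x.
  rewrite (@Rintegral_vanish _ _ _ _ B)//; apply: eq_Rintegral => x.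
  by rewrite inE => /fh ->.
rewrite (Rintegral_affine (c := c) k0 mf); last first.
  apply: (@bounded_support_integrable _ _ _ (enorm (0 : 'rV[R]_d) + r) `|K|) => [|y|y yM].
  - exact: measurableT_comp mf (measurable_affine_rV c k).
  - exact: fK.
  - by apply: f0' => /eball_sub_cube.
have -> : \int[lebesgue_rV d]_x f (c + k *: x) =
    \int[lebesgue_rV d]_(y in eball 0 r) h (c + k *: y).
  rewrite (@Rintegral_vanish _ _ _ _ (eball 0 r))//; apply: eq_Rintegral => y.
  by rewrite inE => ry; rewrite fh//; apply/eball_affine.
have V0 : 0 < fine (lebesgue_rV d (eball 0 r)) by rewrite fine_gt0// eball_gt0// eball_lty.
have -> : fine (lebesgue_rV d (eball c (k * r))) =
    k ^+ d * fine (lebesgue_rV d (eball 0 r)).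
  rewrite (lebesgue_eball_scale c) ?mulr_gt0// (lebesgue_eball_scale 0 r0).
  by rewrite !fineM ?fin_eball//= exprMn mulrA.
by field; rewrite !gt_eqF ?exprn_gt0.
Qed.

(** The mean for [u] is already an average over a ball, so it suffices to transport that average:
    [radial_proj] commutes with the homothety, and the factor [k ^ d] cancels against the ratio of
    volumes. *)
Lemma expectation_affine_sphere (dO : measure_display) (Omega : measurableType dO)
    (Q : probability Omega R) (u : {RV Q >-> 'rV[R]_d}) c (k r : R)
    (g : 'rV[R]_d -> R) (K : R) : (0 < d)%N -> 0 < k -> 0 < r ->
  uniform_on_sphere 0 r u -> measurable_fun setT g ->
  (forall x, esphere c (k * r) x -> `|g x| <= K) ->
  ('E_Q[(fun w => g (c + k *: u w)%R : R)] =
   ((fine (lebesgue_rV d (eball c (k * r)%R)))^-1 *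
    \int[lebesgue_rV d]_(x in eball c (k * r)%R) g (radial_proj c (k * r)%R x))%:E)%E.
Proof.
move=> d0 k0 r0 unifu mg gK; have kr0 : 0 < k * r by rewrite mulr_gt0.
have mg' : measurable_fun setT (fun y => g (c + k *: y)).
  exact: measurableT_comp mg (measurable_affine_rV c k).
have g'K y : esphere 0 r y -> `|g (c + k *: y)| <= K.
  move=> ry; apply: gK; rewrite /esphere/= opprD addrA subrr sub0r enormN enormZ.
  by move: ry; rewrite /esphere/= sub0r enormN gtr0_norm// => ->.
rewrite (expectation_uniform_sphere d0 r0 unifu mg' g'K); congr (_%:E).
rewrite -(@mean_eball_affine c k r (fun x => g (radial_proj c (k * r) x)) _ k0 r0 _
  (radial_proj_bound kr0 gK)).
  by congr (_ * _); apply: eq_Rintegral => y _; rewrite radial_proj_affine.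
exact: measurableT_comp mg (measurable_radial_proj c (k * r)).
Qed.

End affine_sphere.

Theorem claim1 (R : realType) (d : nat) (d_gt0 : (0 < d)%N)
  (alpha : R) (alpha_gt0 : 0 < alpha) (alpha_le1 : alpha <= 1)
  (* the noised data and their smooth density p *)
  (dO : measure_display) (Omega : measurableType dO) (P : probability Omega R)
  (X0 eps : {RV P >-> 'rV[R]_d})
  (X0_eps_indep : independent_RV X0 eps)
  (eps_normal : standard_normal eps)
  (p : 'rV[R]_d -> R)
  (p_density : has_density P
     (fun w => Num.sqrt (1 - alpha) *: X0 w + Num.sqrt alpha *: eps w) p)
  (p_smooth : smooth p)
  (* the given image *)
  (x0 : 'rV[R]_d) (x0_B0 : B0 alpha x0 x0)
  (* both sides are well defined *)
  (crit_dB0 : dB0 alpha x0 `&` critical_points p = set0)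
  (crit_B0 : finite_set (B0 alpha x0 `&` critical_points p))
  (crit_B0_dim1 : d = 1%N -> B0 alpha x0 `&` critical_points p = set0)
  (div_integrable : (lebesgue_rV d).-integrable (B0 alpha x0)
     (EFin \o divergence (normalize \o score p)))
  (* u is uniform on the sphere of radius sqrt d, and x is xtilde given x0 *)
  (dO' : measure_display) (Omega' : measurableType dO')
  (Q : probability Omega' R) (u : {RV Q >-> 'rV[R]_d})
  (u_uniform : uniform_on_sphere 0 (Num.sqrt d%:R) u) :
  (- 'E_Q[fun w => let x := xtilde alpha x0 (u w) in
            dotp (normalize (score p x)) (u_of alpha x0 x + score p x)])%E =
  (Num.sqrt alpha * kappa alpha x0 p - grad_crit alpha x0 p)%:E.
Proof.
set c := Num.sqrt (1 - alpha) *: x0; set r := Num.sqrt (d%:R * alpha).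
have p_ge0 x : 0 <= p x by case: p_density.
have d0 : 0 < d%:R :> R by rewrite ltr0n.
have sd : 0 < Num.sqrt d%:R :> R by rewrite sqrtr_gt0.
have sa : 0 < Num.sqrt alpha by rewrite sqrtr_gt0.
have r0 : 0 < r by rewrite sqrtr_gt0 mulr_gt0.
have rE : r = Num.sqrt alpha * Num.sqrt d%:R by rewrite /r sqrtrM ?ltW// mulrC.
have r2 : r ^+ 2 = d%:R * alpha by rewrite sqr_sqrtr// mulr_ge0// ltW.
pose F x := normalize (gradient p x).
have FE : normalize \o score p = F.
  by apply/funext => x; exact: normalize_score.
have FEx x : normalize (score p x) = F x by rewrite -FE.
have mF : measurable_fun setT F by exact: measurable_normalize_gradient.
have FK x i : `|F x 0 i| <= 1 by exact: normalize_gradient_bound.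
have [Z ZE] : exists Z : seq 'rV[R]_d, B0 alpha x0 `&` critical_points p = [set` Z].
  by apply/finite_seqP; exact: crit_B0.
have sphere_crit x : esphere c r x -> gradient p x <> 0.
  move=> Sx /(score_eq0 p_ge0 p_smooth) sx.
  by have : (dB0 alpha x0 `&` critical_points p) x by []; rewrite crit_dB0.
have reg x : enorm (c - x) <= r -> x \notin Z -> gradient p x <> 0.
  rewrite le_eqVlt => /orP[/eqP Sx _|Bx xZ gx]; first exact: sphere_crit.
  move/negP : xZ; apply; have : (B0 alpha x0 `&` critical_points p) x.
    by split => //; exact/(score_eq0 p_ge0 p_smooth).
  by rewrite ZE.
have SZ x : esphere c r x -> x \notin Z.
  move=> Sx; apply/negP => xZ; have : [set` Z] x by [].
  by rewrite -ZE => -[_ /(score_eq0 p_ge0 p_smooth)]; exact: sphere_crit.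
(* In dimension 1 the direction field is a sign, whose jump at a critical point would not be
   removable. *)
have Zd : (Z = [::] \/ 1 < d)%N.
  have [d1|d1] := eqVneq d 1%N; last by right; rewrite ltn_neqAle eq_sym d1.
  left; move: ZE; rewrite crit_B0_dim1//; case: (Z) => // z s /seteqP[_].
  by move=> /(_ z); rewrite /= inE eqxx => /(_ isT).
have flux_div : \int[lebesgue_rV d]_(x in eball c r) divergence F x =
    d%:R * \int[lebesgue_rV d]_(x in eball c r) flux c F (radial_proj c r x).
  apply: (divergence_ball r0 mF FK _ SZ _ Zd).
  - by move=> x xr xZ i; apply: normalize_gradient_C1 => //; exact: reg.
  - by move: div_integrable; rewrite FE.
have mscore : measurable_fun setT (score p).
  apply: measurable_fun_rV => i.
  have -> : (fun x => score p x 0 i) = (fun x => (p x)^-1 * partial i p x).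
    by apply/funext => x; rewrite scoreE// !mxE.
  apply: measurable_funM.
    apply: measurable_ge0_inv => //; apply: continuous_measurable_rV.
    exact: smooth_continuous.
  by apply: continuous_measurable_rV; exact: smooth_continuous_partial.
have menorm : measurable_fun setT (fun x => enorm (score p x)).
  have := measurableT_comp (measurable_enorm_sub 0) mscore.
  by under eq_fun do rewrite /= sub0r enormN.
(* With no critical point on the sphere, [p] is positive there and the score continuous, hence
   bounded by compactness. *)
have [K1 _ scoreK] : exists2 K, 0 <= K & forall x, esphere c r x -> `|enorm (score p x)| <= K.
  apply: compact_bound; first exact: compact_esphere.
  move=> x Sx.
  have -> : (fun x => enorm (score p x)) = (fun x => (p x)^-1 * enorm (gradient p x)).
    by apply/funext => y; rewrite scoreE// enormZ ger0_norm// invr_ge0.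
  have px : 0 < p x.
    apply: score_neq0_gt0 => // /(score_eq0 p_ge0 p_smooth); exact: sphere_crit.
  apply: (@continuousM _ _ (fun x => (p x)^-1) (fun x => enorm (gradient p x))).
    by apply: (@continuousV _ _ p); [rewrite gt_eqF|exact: smooth_continuous].
  by apply: continuous_enorm => i; exact: continuous_gradient.
pose g1 x := (Num.sqrt alpha)^-1 * dotp (F x) (x - c).
pose g x := g1 x + enorm (score p x).
have mg1 : measurable_fun setT g1.
  by apply: measurable_funM => //; apply: measurable_dotp => //; exact: measurable_subr_rV.
have mg : measurable_fun setT g by exact: measurable_funD.
have g1K x : esphere c r x -> `|g1 x| <= (Num.sqrt alpha)^-1 * (d%:R * (1 * r)).
  move=> Sx; rewrite normrM gtr0_norm ?invr_gt0// ler_pM2l ?invr_gt0//.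
  apply: ler_sum_cst => i; rewrite normrM; apply: ler_pM => //.
  by rewrite -Sx enormB; exact: coord_le_enorm.
have gK x : esphere c r x -> `|g x| <= (Num.sqrt alpha)^-1 * (d%:R * (1 * r)) + K1.
  by move=> Sx; rewrite (le_trans (ler_normD _ _))// lerD// ?g1K// scoreK.
have -> : (fun w => let x := xtilde alpha x0 (u w) in
    dotp (normalize (score p x)) (u_of alpha x0 x + score p x)) =
    (fun w => g (c + Num.sqrt alpha *: u w)).
  apply/funext => w /=; rewrite -/c /xtilde -/c; set x := c + _.
  rewrite dotpDr FEx dotpZr; congr (_ + _).
  (* The inner product of the normalized score with the score is the norm of the score, also where
     the score is 0. *)
  by rewrite -FEx dotpZl -sqr_enorm expr2; have [->|sx] := eqVneq (enorm (score p x)) 0;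
    rewrite ?mulr0// mulKf.
rewrite rE in gK; rewrite (expectation_affine_sphere d_gt0 sa sd u_uniform mg gK) -rE.
rewrite -EFinN; congr (_%:E).
pose V := fine (lebesgue_rV d (eball c r)).
have V0 : 0 < V by rewrite fine_gt0// eball_gt0// eball_lty.
have intB (h : 'rV[R]_d -> R) K : measurable_fun setT h ->
    (forall x, esphere c r x -> `|h x| <= K) ->
    (lebesgue_rV d).-integrable (eball c r) (EFin \o (fun x => h (radial_proj c r x))).
  move=> mh hK; apply: (@bounded_integrable _ _ _ _ _ _ (Num.max K `|h c|)).
  - exact: measurable_eball.
  - exact: eball_lty.
  - exact: measurable_funTS (measurableT_comp mh (measurable_radial_proj c r)).
  - by move=> x _; exact: radial_proj_bound.
rewrite RintegralD; last 3 first.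
- exact: measurable_eball.
- exact: intB g1K.
- exact: intB scoreK.
(* In [r ^ 2 = d * alpha] the factor [d] is the one of [flux_div], and [alpha / sqrt alpha] leaves
   the [sqrt alpha] in front of [kappa]. *)
have -> : \int[lebesgue_rV d]_(x in eball c r) g1 (radial_proj c r x) =
    Num.sqrt alpha * \int[lebesgue_rV d]_(x in eball c r) divergence F x.
  have g1E x : g1 (radial_proj c r x) =
      (Num.sqrt alpha)^-1 * r ^+ 2 * flux c F (radial_proj c r x).
    rewrite /g1 /flux; have [->|xc] := eqVneq x c.
      rewrite radial_proj_center subrr -(scale0r (0 : 'rV[R]_d)) dotpZr !mul0r.
      by rewrite !mulr0.
    rewrite (sqdist_esphere (radial_proj_esphere r0 xc)).
    by field; rewrite !gt_eqF.
  rewrite (eq_Rintegral _ (fun x _ => g1E x)) RintegralZl.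
  - rewrite flux_div r2 -{2}(sqr_sqrtr (ltW alpha_gt0)).
    by field; rewrite gt_eqF.
  - exact: measurable_eball.
  - apply: (intB _ _ (measurable_flux c mF)) => x Sx.
    by apply: flux_bound Sx => // i; exact: FK.
(* In [grad_crit] the factor [d / r] occurs in the integral and in the area of the sphere, and
   cancels. *)
rewrite /kappa /grad_crit -/c -/r FE (integral_sphere d_gt0 r0 menorm scoreK).
rewrite /dB0 -/c -/r sphere_measure_esphere// /B0 -/c -/r -/V.
by field; rewrite !gt_eqF.
Qed.
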